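(* Let $\bar H:G\times\mathfrak g^*\to\mathbb R$ be a Hamiltonian function. Then the set $$S'=\{p\in{}^1TT^*G:\ -\big(({}^1\tau)^*d\bar H\big)(p)=\theta_1(p)\}$$ defined by the equation $-({}^1\tau)^*d\bar H=\theta_1$ is a Lagrangian submanifold of $({}^1TT^*G,\Omega_{{}^1TT^*G})$ and determines the trivialized Hamilton's equations $$\frac{dg}{dt}=T_eR_g\left(\frac{\delta\bar H}{\delta\mu}\right),\qquad\frac{d\mu}{dt}=ad^*_{\frac{\delta\bar H}{\delta\mu}}\mu-T_e^*R_g\frac{\delta\bar H}{\delta g};$$ that is, a curve $(g(t),\mu(t))$ in $G\times\mathfrak g^*$ has trivialized velocity lying in $S'$ for all $t$ if and only if it satisfies these equations.
   Context: $G$ is a Lie group with identity $e$, and $\mathfrak g\simeq T_eG$ is its Lie algebra, assumed reflexive ($\mathfrak g^{**}=\mathfrak g$), with dual $\mathfrak g^*$. $R_g$ is right multiplication. The bracket on $\mathfrak g$ is that of right invariant vector fields: $X^G_{[\xi,\eta]}=[X^G_\xi,X^G_\eta]_{JL}$ (Jacobi-Lie bracket), where $X^G_\xi(g)=T_eR_g\xi$. $\langle ad^*_\xi\mu,\eta\rangle=\langle\mu,[\xi,\eta]\rangle$. $T_e^*R_g:T_g^*G\to\mathfrak g^*$ is the dual of $T_eR_g$. $\delta\bar H/\delta g\in T_g^*G$ and $\delta\bar H/\delta\mu\in\mathfrak g$ are partial derivatives. The trivialized Tulczyjew's symplectic space is, as a manifold, ${}^1TT^*G=(G\times\mathfrak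 g^* )\times(\mathfrak g\times\mathfrak g^* )$ with points $(g,\mu,\xi,\nu)$. It is identified with $T(G\times\mathfrak g^* )$ by the trivialization $$(V_g,V_\mu)\in T_{(g,\mu)}(G\times\mathfrak g^* )\ \mapsto\ \big(g,\mu,\xi,V_\mu-ad^*_\xi\mu\big),\qquad \xi=T_gR_{g^{-1}}V_g.$$ The trivialized velocity of a curve $(g(t),\mu(t))$ is the image of $(\dot g,\dot\mu)$ under this map. The (tangent bundle) projection is ${}^1\tau:{}^1TT^*G\to G\times\mathfrak g^*$, $(g,\mu,\xi,\nu)\mapsto(g,\mu)$. At a point $(g,\mu,\xi,\nu)$ every tangent vector is uniquely of the form $$X_{(\xi_2,\nu_2,\xi_3,\nu_3)}=\big(T_eR_g\xi_2,\ \nu_2+ad^*_{\xi_2}\mu,\ \xi_3+[\xi,\xi_2],\ \nu_3+ad^*_{\xi_2}\nu-ad^*_\xi\nu_2\big)$$ with $\xi_2,\xi_3\in\mathfrak g$, $\nu_2,\nu_3\in\mathfrak g^*$. The one-form $\theta_1$ is defined by $$\langle\theta_1,X_{(\xi_2,\nu_2,\xi_3,\nu_3)}\rangle=\langle\nu,\xi_2\rangle-\langle\nu_2,\xi\rangle+\langle\mu,[\xi,\xi_2]\rangle,$$ and the symplectic two-form is $\Omega_{{}^1TT^*G}=d\theta_1$. *)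

(* Defs.v *)
From HB Require Import structures.
From mathcomp Require Import all_boot all_order all_algebra.
From mathcomp Require Import all_classical all_reals all_analysis.
Set Implicit Arguments.
Unset Strict Implicit.
Unset Printing Implicit Defensive.
Import Order.TTheory GRing.Theory Num.Theory.
Import numFieldNormedType.Exports.
Local Open Scope classical_set_scope.
Local Open Scope ring_scope.

Section Dual.
Context {R : realType} (E : normedModType R).

Definition continuous_linear : {pred E -> R} :=
  fun f => `[< (forall (a : R) x y, f (a *: x + y) = a * f x + f y) /\
               continuous f >].

Fact continuous_linear_submod_closed : submod_closed continuous_linear.
Proof.
split.
- apply/asboolP; split; first by move=> a x y; rewrite /= mulr0 addr0.
  by move=> x; exact: cvg_cst.
- move=> a f g /asboolP[lf cf] /asboolP[lg cg]; apply/asboolP; split.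
    move=> b x y.
    have E1 z : (a *: f + g) z = a * f z + g z by [].
    rewrite !E1 lf lg !mulrDr !mulrA (mulrC b a) -!addrA; congr (_ + _).
    by rewrite addrCA.
  move=> x; apply: (@continuousD _ _ _ (a *: f) g); last exact: cg.
  by exact: (@continuousM _ _ (cst a) f x (cvg_cst _) (cf x)).
Qed.

HB.instance Definition _ :=
  GRing.isSubmodClosed.Build R (E -> R) continuous_linear
    continuous_linear_submod_closed.

Record dual_space := Dual {
  dual_fun :> E -> R ;
  _ : dual_fun \in continuous_linear }.

HB.instance Definition _ := [isSub for dual_fun].
HB.instance Definition _ := [Choice of dual_space by <:].
HB.instance Definition _ := [SubChoice_isSubLmodule of dual_space by <:].

Lemma dualP (f : dual_space) :
  (forall (a : R) x y, f (a *: x + y) = a * f x + f y) /\ continuous f.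
Proof. by case: f => f /= /asboolP. Qed.

Fact dual_linear (f : dual_space) : linear f.
Proof. by move=> a x y; case: (dualP f) => ->. Qed.

HB.instance Definition _ (f : dual_space) :=
  GRing.isLinear.Build R E R *:%R (f : E -> R) (dual_linear f).

Definition unit_values (f : dual_space) : set R :=
  [set `|f x| | x in [set x | `|x| <= 1]].

Definition dual_norm (f : dual_space) : R := sup (unit_values f).

Lemma has_sup_unit_values (f : dual_space) : has_sup (unit_values f).
Proof.
split; first by exists `|f 0|; exists 0 => //=; rewrite normr0.
have [_ cf] := dualP f.
have /linear_bounded_continuous/linear_boundedP := cf.
move=> /pinfty_ex_gt0[r r0 fr]; exists r => _ [x /= x1 <-].
by rewrite (le_trans (fr x))// ler_piMr// ltW.
Qed.

Fact ler_dual_normD f g : dual_norm (f + g) <= dual_norm f + dual_norm g.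
Proof.
apply: ge_sup; first by case: (has_sup_unit_values (f + g)).
move=> _ [x /= x1 <-].
rewrite -[X in `|X|]/(f x + g x) (le_trans (ler_normD _ _))//.
by apply: lerD; apply: (sup_upper_bound (has_sup_unit_values _)); exists x.
Qed.

Fact dual_normZ (a : R) f : dual_norm (a *: f) = `|a| * dual_norm f.
Proof.
have le1 b h : dual_norm (b *: h) <= `|b| * dual_norm h.
  apply: ge_sup; first by case: (has_sup_unit_values (b *: h)).
  move=> _ [x /= x1 <-]; rewrite -[X in `|X|]/(b * h x) normrM ler_wpM2l//.
  by apply: (sup_upper_bound (has_sup_unit_values _)); exists x.
apply/eqP; rewrite eq_le le1/=.
have [->|a0] := eqVneq a 0.
  rewrite normr0 mul0r; apply: le_trans (sup_upper_bound _ _); last first.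
  - by exists 0 => //=; rewrite normr0.
  - exact: has_sup_unit_values.
  - exact: normr_ge0.
rewrite -ler_pdivlMl ?normr_gt0// -normfV.
by have := le1 a^-1 (a *: f); rewrite scalerK.
Qed.

Fact dual_norm0_eq0 f : dual_norm f = 0 -> f = 0.
Proof.
move=> f0; apply/val_inj/funext => x /=.
have [->|x0] := eqVneq x 0; first by rewrite linear0.
have nx : `|x| != 0 by rewrite normr_eq0.
have /eqP : f (`|x|^-1 *: x) = 0.
  apply/eqP; rewrite -normr_le0 -f0.
  apply: (sup_upper_bound (has_sup_unit_values _)).
  by exists (`|x|^-1 *: x) => //=; rewrite normrZ normfV normr_id mulVf.
by rewrite linearZ/= mulf_eq0 invr_eq0 (negbTE nx)/= => /eqP.
Qed.

HB.instance Definition _ :=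
  Lmodule_isNormed.Build R dual_space ler_dual_normD dual_normZ dual_norm0_eq0.

(** 0 if [f] is not linear and continuous; this does not happen below, see
    [ad_starE], [right_cotrivE] and [delta_gE]. *)
Definition to_dual (f : E -> R) : dual_space := insubd (0 : dual_space) f.

Lemma to_dualE (f : E -> R) :
  (forall (a : R) x y, f (a *: x + y) = a * f x + f y) -> continuous f ->
  to_dual f = f :> (E -> R).
Proof. by move=> lf cf; rewrite /to_dual insubdK//; exact/asboolP. Qed.

End Dual.

Definition reflexive_space {R : realType} (E : normedModType R) :=
  forall Phi : dual_space (dual_space E), exists x : E,
    forall mu : dual_space E, Phi mu = mu x.

Lemma openX (T1 T2 : topologicalType) (A : set T1) (B : set T2) :
  open A -> open B -> open (A `*` B).
Proof.
rewrite !openE => oA oB [x y] [/= Ax By].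
by exists (A, B) => //; split; [exact: oA|exact: oB].
Qed.

Section Smooth.
Context {R : realType}.
Implicit Types E F V : normedModType R.

(** [Cn n U f], for [U] open: [f] is of class C^n on [U] in the sense that its
    iterated tangent maps [(x, v) |-> 'd f x v] exist and are continuous; on
    normed spaces this notion and the one based on the operator norm of the
    iterated differentials have the same C^oo maps. *)
Fixpoint Cn (n : nat) E F (U : set E) (f : E -> F) {struct n} : Prop :=
  match n with
  | 0%N => forall x, U x -> {for x, continuous f}
  | m.+1 => (forall x, U x -> differentiable f x) /\
            Cn m (U `*` setT) (fun p : E * E => 'd f (p.1) p.2)
  end.

Definition smooth_on E F (U : set E) (f : E -> F) := forall n, Cn n U f.

Lemma near_eq_diff E F (f g : E -> F) (x : E) :
  (\forall y \near x, f y = g y) -> differentiable f x ->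
  differentiable g x /\ 'd g x = 'd f x :> (E -> F).
Proof.
move=> fg df.
have fgx : f x = g x := nbhs_singleton fg.
have cdf : continuous ('d f x) by exact: diff_continuous.
have key : g \o shift x = cst (g x) + 'd f x +o_ 0 id.
  apply/eqaddoP => e e0.
  have /eqaddoP/(_ e e0) := diff_locally df.
  have : \forall y \near (0 : E), f (y + x) = g (y + x).
    have := fg; rewrite (near_shift 0 x) subr0 => H.
    by apply: filterS H.
  apply: filterS2 => y yfg; rewrite /= !fctE /=.
  by rewrite -fgx /= yfg.
have dg : 'd g x = 'd f x :> (E -> F) by apply: diff_unique.
split=> //; apply/diff_locallyP; split; first by rewrite dg.
by rewrite dg.
Qed.

Lemma Cn_eq n E F (U : set E) (f g : E -> F) : open U ->
  (forall x, U x -> f x = g x) -> Cn n U f -> Cn n U g.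
Proof.
elim: n E F U f g => [|n IH] E F U f g oU fg /=.
  move=> cf x Ux; have nU : nbhs x U by exact: open_nbhs_nbhs.
  rewrite /prop_for /continuous_at -(fg _ Ux).
  by apply: cvg_trans (cf x Ux); apply: near_eq_cvg; apply: filterS nU.
have fgn x : U x -> \forall y \near x, f y = g y.
  move=> Ux; have nU : nbhs x U by exact: open_nbhs_nbhs.
  exact: filterS nU.
move=> [df Cf]; split.
  by move=> x Ux; case: (near_eq_diff (fgn x Ux) (df x Ux)).
apply: IH Cf; first exact: openX openT.
by move=> [x v] [/= Ux _]; case: (near_eq_diff (fgn x Ux) (df x Ux)) => _ ->.
Qed.

Lemma Cn_pair n E F V (U : set E) (f : E -> F) (g : E -> V) : open U ->
  Cn n U f -> Cn n U g -> Cn n U (fun x => (f x, g x)).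
Proof.
elim: n E F V U f g => [|n IH] E F V U f g oU /=.
  by move=> cf cg x Ux; apply: cvg_pair; [exact: cf|exact: cg].
move=> [df Cf] [dg Cg]; split.
  by move=> x Ux; apply: differentiable_pair; [exact: df|exact: dg].
have oUT : open (U `*` [set: E]) by exact: openX openT.
apply: Cn_eq (IH _ _ _ _ _ _ oUT Cf Cg) => // -[x v] [/= Ux _].
by rewrite diff_pair//; [exact: df|exact: dg].
Qed.

Lemma Cn_linear n E F (U : set E) (f : {linear E -> F}) :
  open U -> continuous f -> Cn n U f.
Proof.
elim: n E F U f => [|n IH] E F U f oU cf /=; first by move=> x _; exact: cf.
split; first by move=> x _; exact: linear_differentiable.
have oUT : open (U `*` [set: E]) by exact: openX openT.
have cfs : continuous (f \o snd : E * E -> F).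
  by move=> p; apply: continuous_comp; [exact: cvg_snd|exact: cf].
apply: Cn_eq (IH _ _ _ (f \o snd : {linear (E * E)%type -> F}) oUT cfs) => //.
by move=> [x v] _ /=; rewrite diff_lin.
Qed.

Lemma Cn_comp_linear n E F V (U : set E) (W : set F) (L : {linear E -> F})
    (f : F -> V) : open U -> open W -> continuous L ->
  (forall x, U x -> W (L x)) -> Cn n W f -> Cn n U (f \o L).
Proof.
elim: n E F V U W L f => [|n IH] E F V U W L f oU oW cL UW /=.
  move=> cf x Ux; apply: continuous_comp; first exact: cL.
  exact/cf/UW.
move=> [df Cf].
have dL x : differentiable L x by exact: linear_differentiable.
split.
  by move=> x Ux; apply: differentiable_comp => //; exact/df/UW.
have oUT : open (U `*` [set: E]) by exact: openX openT.
have oWT : open (W `*` [set: F]) by exact: openX openT.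
pose LL (p : E * E) : F * F := (L p.1, L p.2).
have linLL : linear LL.
  by move=> a [x1 x2] [y1 y2]; rewrite /LL /= !linearP.
pose LLm := GRing.isLinear.Build _ _ _ _ _ linLL.
pose LLl : {linear (E * E)%type -> (F * F)%type} := HB.pack LL LLm.
have cLL : continuous LLl.
  move=> p; apply: cvg_pair => /=.
    by apply: (@continuous_comp _ _ _ fst L p); [exact: cvg_fst|exact: cL].
  by apply: (@continuous_comp _ _ _ snd L p); [exact: cvg_snd|exact: cL].
have UWT p : (U `*` [set: E]) p -> (W `*` [set: F]) (LLl p).
  by case: p => x v [/= Ux _]; split => //=; exact: UW.
apply: Cn_eq (IH _ _ _ _ _ LLl _ oUT oWT cLL UWT Cf) => //.
move=> [x v] [/= Ux _]; rewrite (diff_comp (dL x) (df _ (UW _ Ux))).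
by rewrite /= diff_lin.
Qed.

Lemma smooth_on_prod E1 E2 F1 F2 (U1 : set E1) (U2 : set E2)
    (f1 : E1 -> F1) (f2 : E2 -> F2) : open U1 -> open U2 ->
  smooth_on U1 f1 -> smooth_on U2 f2 ->
  smooth_on (U1 `*` U2) (fun p : E1 * E2 => (f1 p.1, f2 p.2)).
Proof.
move=> o1 o2 s1 s2 n; have oU : open (U1 `*` U2) by exact: openX.
apply: Cn_pair => //.
- apply: (@Cn_comp_linear n _ _ _ _ U1 (fst : {linear (E1 * E2)%type -> E1}) f1) => //.
  + by move=> p; exact: cvg_fst.
  + by move=> p [].
- apply: (@Cn_comp_linear n _ _ _ _ U2 (snd : {linear (E1 * E2)%type -> E2}) f2) => //.
  + by move=> p; exact: cvg_snd.
  + by move=> p [].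
Qed.

End Smooth.

Section Manifold.
Context {R : realType}.
Implicit Types E F : normedModType R.

Record chart (M : topologicalType) E := Chart {
  chart_dom : set M ;
  chart_fun :> M -> E ;
  chart_inv : E -> M }.

Definition chart_cod (M : topologicalType) E (c : chart M E) : set E :=
  c @` chart_dom c.

Definition is_chart (M : topologicalType) E (c : chart M E) : Prop :=
  [/\ open (chart_dom c), open (chart_cod c),
      forall p, chart_dom c p -> chart_inv c (c p) = p,
      forall p, chart_dom c p -> {for p, continuous c} &
      forall x, chart_cod c x -> {for x, continuous (chart_inv c)}].

Definition transition_dom (M : topologicalType) E (c c' : chart M E) : set E :=
  chart_cod c `&` chart_inv c @^-1` chart_dom c'.

(** An atlas is indexed by the points of the manifold, [c p] being a chart at
    [p]; every atlas contains one of this form which defines the same smooth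
    structure. *)
Definition smooth_atlas (M : topologicalType) E (c : M -> chart M E) : Prop :=
  [/\ forall p, is_chart (c p),
      forall p, chart_dom (c p) p &
      forall p q, smooth_on (transition_dom (c p) (c q))
                            (c q \o chart_inv (c p))].

(** The tangent space of [M] at [p] is represented by the model space [E], by
    means of the chart [chart_at p]. *)
Record manifold E := Manifold {
  mfd_sort :> topologicalType ;
  chart_at : mfd_sort -> chart mfd_sort E ;
  _ : smooth_atlas chart_at }.

Lemma manifold_atlas E (M : manifold E) : smooth_atlas (@chart_at E M).
Proof. by case: M. Qed.

Definition id_chart E (x : E) : chart E E := Chart setT id id.

Fact id_chart_atlas E : smooth_atlas (@id_chart E).
Proof.
split=> [x|//|x y].
  have cod : chart_cod (id_chart x) = setT by rewrite /chart_cod /= image_id.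
  split=> //; first exact: openT.
  - by rewrite cod; exact: openT.
  - by move=> y _; exact: cvg_id.
  - by move=> y _; exact: cvg_id.
have oT : open (transition_dom (id_chart x) (id_chart y)).
  rewrite (_ : transition_dom _ _ = setT); first exact: openT.
  by apply/seteqP; split=> // z _; split => //; exists z.
move=> n; apply: (@Cn_linear R n E E _ (idfun : {linear E -> E}) oT) => z.
exact: cvg_id.
Qed.

Definition vec_mfd E : manifold E := Manifold (@id_chart_atlas E).

Section Product.
Context (E F : normedModType R) (M : manifold E) (N : manifold F).

Definition prod_chart (p : M * N) : chart (M * N)%type (E * F)%type :=
  Chart (chart_dom (chart_at p.1) `*` chart_dom (chart_at p.2))
    (fun q => (chart_at p.1 q.1, chart_at p.2 q.2))
    (fun x => (chart_inv (chart_at p.1) x.1, chart_inv (chart_at p.2) x.2)).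

Lemma prod_chart_cod p : chart_cod (prod_chart p) =
  chart_cod (chart_at p.1) `*` chart_cod (chart_at p.2).
Proof.
apply/seteqP; split=> [_ [[q1 q2] [/= d1 d2] <-]|[_ _] [/= [q1 d1 <-] [q2 d2 <-]]].
  by split; [exists q1|exists q2].
by exists (q1, q2).
Qed.

Fact prod_chart_atlas : smooth_atlas prod_chart.
Proof.
have [cM dM tM] := manifold_atlas M; have [cN dN tN] := manifold_atlas N.
split=> [[p1 p2]|[p1 p2]|[p1 p2] [q1 q2]].
- have [oM oM' kM fM iM] := cM p1; have [oN oN' kN fN iN] := cN p2.
  split.
  + exact: openX.
  + by rewrite prod_chart_cod; exact: openX.
  + by move=> [x y] [/= dx dy]; rewrite kM ?kN.
  + move=> [x y] [/= dx dy]; apply: cvg_pair => /=.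
      apply: (@continuous_comp _ _ _ fst (chart_at p1) (x, y)).
        exact: cvg_fst.
      exact: fM.
    apply: (@continuous_comp _ _ _ snd (chart_at p2) (x, y)).
      exact: cvg_snd.
    exact: fN.
  + rewrite prod_chart_cod => -[x y] [/= dx dy]; apply: cvg_pair => /=.
      apply: (@continuous_comp _ _ _ fst (chart_inv (chart_at p1)) (x, y)).
        exact: cvg_fst.
      exact: iM.
    apply: (@continuous_comp _ _ _ snd (chart_inv (chart_at p2)) (x, y)).
      exact: cvg_snd.
    exact: iN.
- by split=> /=; [exact: dM|exact: dN].
- have openT1 E' (M' : manifold E') (p q : M') :
      open (transition_dom (chart_at p) (chart_at q)).
    have [cM' _ _] := manifold_atlas M'; have [_ o' _ _ i'] := cM' p.
    have [oq _ _ _ _] := cM' q.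
    rewrite openE => x [cx dx].
    have n1 : nbhs x (chart_cod (chart_at p)) by exact: open_nbhs_nbhs.
    have n2 : nbhs x (chart_inv (chart_at p) @^-1` chart_dom (chart_at q)).
      by apply: (i' x cx); exact: open_nbhs_nbhs.
    exact: filterI n1 n2.
  have -> : transition_dom (prod_chart (p1, p2)) (prod_chart (q1, q2)) =
      transition_dom (chart_at p1) (chart_at q1) `*`
      transition_dom (chart_at p2) (chart_at q2).
    rewrite /transition_dom prod_chart_cod; apply/seteqP.
    by split=> -[x y] [[? ?] [? ?]].
  exact: (smooth_on_prod (openT1 _ M p1 q1) (openT1 _ N p2 q2)
                         (tM p1 q1) (tN p2 q2)).
Qed.

Definition prod_mfd : manifold (E * F)%type := Manifold prod_chart_atlas.

End Product.

Definition local_rep E F (M : manifold E) (N : manifold F) (f : M -> N) (p : M)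
    : E -> F :=
  chart_at (f p) \o f \o chart_inv (chart_at p).

Definition smooth_at E F (M : manifold E) (N : manifold F) (f : M -> N) (p : M)
    : Prop :=
  {for p, continuous f} /\
  exists U : set E, [/\ open U, U (chart_at p p) & smooth_on U (local_rep f p)].

Definition smooth_map E F (M : manifold E) (N : manifold F) (f : M -> N) :=
  forall p, smooth_at f p.

(** The tangent map T_p M -> T_(f p) N. *)
Definition tangent_map E F (M : manifold E) (N : manifold F) (f : M -> N)
    (p : M) : E -> F :=
  'd (local_rep f p) (chart_at p p).

(** The differential at [p] of a function on [M], a covector at [p]. *)
Definition differential E (M : manifold E) (f : M -> R) (p : M) : E -> R :=
  @tangent_map E R M (vec_mfd R) f p.

Definition curve_differentiable E (M : manifold E) (c : R -> M) (t : R) : Prop :=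
  {for t, continuous c} /\ derivable (chart_at (c t) \o c) t 1.

Definition velocity E (M : manifold E) (c : R -> M) (t : R) : E :=
  'D_1 (chart_at (c t) \o c) t.

(** The representative of the vector field [X] in the chart at [p]. *)
Definition field_rep E (M : manifold E) (X : M -> E) (p : M) (x : E) : E :=
  let q := chart_inv (chart_at p) x in
  @tangent_map E E M (vec_mfd E) (chart_at p) q (X q).

(** [X, Y]_JL at [p] is DY.X - DX.Y in a chart at [p]. *)
Definition jacobi_lie E (M : manifold E) (X Y : M -> E) (p : M) : E :=
  let x := chart_at p p in
  'd (field_rep Y p) x (field_rep X p x) - 'd (field_rep X p) x (field_rep Y p x).

(** [form_rep th p x] is the value at [x] of the representative of the one-form
    [th] in the chart at [p]. *)
Definition form_rep E (M : manifold E) (th : M -> E -> R) (p : M) (x v : E) : R :=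
  let q := chart_inv (chart_at p) x in
  th q (@tangent_map E E (vec_mfd E) M (chart_inv (chart_at p)) x v).

Definition exterior_derivative E (M : manifold E) (th : M -> E -> R) (p : M)
    (u v : E) : R :=
  let x := chart_at p p in
  'd (fun y => form_rep th p y v) x u - 'd (fun y => form_rep th p y u) x v.

Definition pullback E F (M : manifold E) (N : manifold F) (f : M -> N)
    (th : N -> F -> R) (p : M) (v : E) : R :=
  th (f p) (tangent_map f p v).

(** A chart of [M] on [U], with values in the product [F1 * F2], in which [S] is
    given by the vanishing of the second component. *)
Record slice_chart E (M : manifold E) (S : set M) F1 F2 (U : set M)
    (V : set (F1 * F2)) (f : M -> vec_mfd (F1 * F2)%type)
    (h : vec_mfd (F1 * F2)%type -> M) : Prop := SliceChart {
  slice_open_dom : open U ;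
  slice_open_cod : open V ;
  slice_fun : forall q, U q -> [/\ V (f q), h (f q) = q & smooth_at f q] ;
  slice_inv : forall x, V x -> [/\ U (h x), f (h x) = x & smooth_at h x] ;
  slice_mem : forall q, U q -> (S q <-> (f q).2 = 0) }.

Definition submanifold E (M : manifold E) (S : set M) : Prop :=
  forall p, S p ->
  exists (F1 F2 : normedModType R) (U : set M) (V : set (F1 * F2))
    (f : M -> vec_mfd (F1 * F2)%type) (h : vec_mfd (F1 * F2)%type -> M),
    U p /\ slice_chart S U V f h.

(** The velocities at [p] of the smooth curves drawn on [S]. *)
Definition tangent_space E (M : manifold E) (S : set M) (p : M) : set E :=
  [set v | exists c : vec_mfd R -> M,
     [/\ smooth_at c 0, c 0 = p, \forall t \near (0 : R), S (c t) &
         velocity c 0 = v]].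

Definition omega_orthogonal E (omega : E -> E -> R) (L : set E) : set E :=
  [set v | forall w, L w -> omega v w = 0].

Definition lagrangian_submanifold E (M : manifold E) (Omega : M -> E -> E -> R)
    (S : set M) : Prop :=
  submanifold S /\
  forall p, S p -> tangent_space S p = omega_orthogonal (Omega p) (tangent_space S p).

End Manifold.

Section TangentMap.
Context {R : realType}.

Definition differentiable_at (E F : normedModType R) (M : manifold E)
    (N : manifold F) (f : M -> N) (p : M) : Prop :=
  {for p, continuous f} /\ differentiable (local_rep f p) (chart_at p p).

Lemma smooth_differentiable_at (E F : normedModType R) (M : manifold E)
    (N : manifold F) (f : M -> N) (p : M) :
  smooth_at f p -> differentiable_at f p.
Proof. by move=> [cf [U [oU Up /(_ 1%N)[df _]]]]; split => //; exact: df. Qed.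

Lemma chart_atK (E : normedModType R) (M : manifold E) (p q : M) :
  chart_dom (chart_at p) q -> chart_inv (chart_at p) (chart_at p q) = q.
Proof. by have [cM _ _] := manifold_atlas M; have [_ _ + _ _] := cM p; exact. Qed.

Lemma chart_at_dom (E : normedModType R) (M : manifold E) (p : M) :
  chart_dom (chart_at p) p.
Proof. by have [_ + _] := manifold_atlas M; exact. Qed.

Lemma near_chart_cod (E : normedModType R) (M : manifold E) (p : M) :
  \forall x \near chart_at p p, chart_cod (chart_at p) x.
Proof.
have [cM _ _] := manifold_atlas M; have [_ oc _ _ _] := cM p.
by apply: open_nbhs_nbhs; split => //; exists p => //; exact: chart_at_dom.
Qed.

Lemma near_chart_dom (E : normedModType R) (M : manifold E) (p : M) :
  \forall q \near p, chart_dom (chart_at p) q.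
Proof.
have [cM _ _] := manifold_atlas M; have [od _ _ _ _] := cM p.
by apply: open_nbhs_nbhs; split => //; exact: chart_at_dom.
Qed.

Lemma near_chart_inv (E : normedModType R) (M : manifold E) (p : M) (A : set M) :
  nbhs p A -> \forall x \near chart_at p p, A (chart_inv (chart_at p) x).
Proof.
move=> nA; have [cM _ _] := manifold_atlas M; have [_ _ _ _ ci] := cM p.
have cp : chart_cod (chart_at p) (chart_at p p).
  by exists p => //; exact: chart_at_dom.
by apply: (ci _ cp); rewrite chart_atK//; exact: chart_at_dom.
Qed.

Lemma tangent_map_near (E F : normedModType R) (M : manifold E)
    (N : manifold F) (f g : M -> N) (p : M) :
  (\forall q \near p, f q = g q) -> differentiable_at f p ->
  differentiable_at g p /\ tangent_map g p = tangent_map f p.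
Proof.
move=> fg [cf df]; have fgp : f p = g p := nbhs_singleton fg.
have fg' : \forall x \near chart_at p p, local_rep f p x = local_rep g p x.
  by apply: filterS (near_chart_inv fg) => x fx; rewrite /local_rep /= fx fgp.
have [dg dE] := near_eq_diff fg' df; split; last by rewrite /tangent_map dE.
split=> //.
rewrite /prop_for /continuous_at -fgp.
by apply: cvg_trans cf; exact: near_eq_cvg.
Qed.

Lemma tangent_map_comp (E F V : normedModType R) (M : manifold E)
    (N : manifold F) (P : manifold V) (f : M -> N) (g : N -> P) (p : M) :
  differentiable_at f p -> differentiable_at g (f p) ->
  differentiable_at (g \o f) p /\
  tangent_map (g \o f) p = tangent_map g (f p) \o tangent_map f p.
Proof.
move=> [cf df] [cg dg].
have lfp : local_rep f p (chart_at p p) = chart_at (f p) (f p).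
  by rewrite /local_rep /= chart_atK//; exact: chart_at_dom.
have dg' : differentiable (local_rep g (f p)) (local_rep f p (chart_at p p)).
  by rewrite lfp.
have near_comp : \forall x \near chart_at p p,
    (local_rep g (f p) \o local_rep f p) x = local_rep (g \o f) p x.
  have nd : \forall q \near p, chart_dom (chart_at (f p)) (f q).
    by apply: cf; exact: near_chart_dom.
  by apply: filterS (near_chart_inv nd) => x dx; rewrite /local_rep /= chart_atK.
have [dgf dE] := near_eq_diff near_comp (differentiable_comp df dg').
split; first by split => //; exact: continuous_comp.
by rewrite /tangent_map dE (diff_comp df dg') lfp.
Qed.

Lemma tangent_map_id (E : normedModType R) (M : manifold E) (p : M) :
  differentiable_at (@id M) p /\ tangent_map (@id M) p = id.
Proof.
have near_id : \forall x \near chart_at p p, x = local_rep (@id M) p x.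
  apply: filterS (@near_chart_cod E M p) => _ [q dq <-].
  by rewrite /local_rep /= chart_atK.
have did : differentiable (@id E) (chart_at p p) by exact: ex_diff.
have [d dE] := near_eq_diff near_id did.
split; first by split => //; exact: cvg_id.
by rewrite /tangent_map dE; exact: diff_val.
Qed.

End TangentMap.

#[short(type="topologicalGroupType")]
HB.structure Definition TopologicalGroup := {G of Topological G & Group G}.

Section LieGroup.
Context {R : realType}.

(** Lie groups modelled on the Banach space [E]. No separation axiom is needed:
    a topological group which is locally homeomorphic to [E] is Hausdorff. *)
Record lieGroup (E : completeNormedModType R) := LieGroup {
  lie_sort : topologicalGroupType ;
  lie_chart : lie_sort -> chart lie_sort E ;
  lie_atlas : smooth_atlas lie_chart ;
  lie_mul_smooth : let G := Manifold lie_atlas in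
      smooth_map (M := prod_mfd G G) (N := G)
        (fun p : lie_sort * lie_sort => (p.1 * p.2)%g) ;
  lie_inv_smooth : let G := Manifold lie_atlas in
      smooth_map (M := G) (N := G) (fun g : lie_sort => g^-1%g) }.

Definition lie_mfd E (G : lieGroup E) : manifold E := Manifold (lie_atlas G).
Coercion lie_mfd : lieGroup >-> manifold.

Context {E : completeNormedModType R} (G : lieGroup E).

(** The Lie algebra T_e G is represented by [E], by means of the chart at the
    identity, and its dual by [dual_space E]. *)

Definition right_mul (g : G) : G -> G :=
  fun h => ((h : lie_sort G) * (g : lie_sort G))%g.

Definition lie_one : G := 1%g : lie_sort G.

Definition lie_inv (g : G) : G := (g : lie_sort G)^-1%g.

(** [xi |-> T_e R_g xi] *)
Definition right_field (xi : E) (g : G) : E :=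
  tangent_map (right_mul g) lie_one xi.

(** [V |-> T_g R_(g^-1) V], from T_g G to the Lie algebra. *)
Definition right_triv (g : G) (V : E) : E :=
  tangent_map (right_mul (lie_inv g)) g V.

Lemma right_mul_differentiable (g h : G) : differentiable_at (right_mul g) h.
Proof.
have [cm dm] : differentiable_at (M := prod_mfd G G) (N := G)
    (fun p : G * G => right_mul p.2 p.1) (h, g).
  by apply: smooth_differentiable_at; exact: (@lie_mul_smooth E G).
split.
  apply: (@continuous_comp _ _ _ (fun x : G => (x, g))
    (fun p : G * G => right_mul p.2 p.1) h) => //.
  by apply: cvg_pair; [exact: cvg_id|exact: cvg_cst].
have -> : local_rep (right_mul g) h =
    local_rep (M := prod_mfd G G) (N := G)
      (fun p : G * G => right_mul p.2 p.1) (h, g) \o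
    (fun x : E => (x, chart_at g g)).
  apply/funext => x; rewrite -[RHS]/(chart_at (right_mul g h) (right_mul
    (chart_inv (chart_at g) (chart_at g g)) (chart_inv (chart_at h) x))).
  by rewrite chart_atK//; exact: chart_at_dom.
by apply: differentiable_comp.
Qed.

Lemma right_mulK (g : G) : right_mul (lie_inv g) \o right_mul g = id.
Proof. by apply/funext => h; rewrite /right_mul /lie_inv /= mulgK. Qed.

Lemma right_mulVK (g : G) : right_mul g \o right_mul (lie_inv g) = id.
Proof. by apply/funext => h; rewrite /right_mul /lie_inv /= mulgVK. Qed.

Lemma right_fieldK (g : G) : cancel (right_field^~ g) (right_triv g).
Proof.
move=> xi; have [_ /esym] := tangent_map_comp
  (right_mul_differentiable g lie_one)
  (right_mul_differentiable (lie_inv g) (right_mul g lie_one)).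
rewrite right_mulK (tangent_map_id _).2 => /(congr1 (@^~ xi)) /=.
by rewrite /right_triv /right_field {2}/right_mul /lie_one mul1g.
Qed.

Lemma right_trivK (g : G) : cancel (right_triv g) (right_field^~ g).
Proof.
move=> V; have [_ /esym] := tangent_map_comp
  (right_mul_differentiable (lie_inv g) g)
  (right_mul_differentiable g (right_mul (lie_inv g) g)).
rewrite right_mulVK (tangent_map_id _).2 => /(congr1 (@^~ V)) /=.
by rewrite /right_triv /right_field {2}/right_mul /lie_one /lie_inv mulgV.
Qed.

Definition bracket (xi eta : E) : E :=
  jacobi_lie (right_field xi) (right_field eta) lie_one.

Definition ad_star (xi : E) (mu : dual_space E) : dual_space E :=
  to_dual (fun eta => mu (bracket xi eta)).

(** T_e^* R_g, the covectors at [g] being represented in the chart at [g]. *)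
Definition right_cotriv (g : G) (alpha : dual_space E) : dual_space E :=
  to_dual (fun xi => alpha (right_field xi g)).

(** Points [(g, mu)] and [((g, mu), (xi, nu))] respectively. *)
Definition TstarG := prod_mfd G (vec_mfd (dual_space E)).
Definition TTstarG := prod_mfd TstarG (vec_mfd (E * dual_space E)%type).

Definition tau : TTstarG -> TstarG := fun p => p.1.

Definition trivialize (q : TstarG) (V : E * dual_space E) : TTstarG :=
  let xi := right_triv q.1 V.1 in
  (q, (xi, V.2 - ad_star xi q.2)).

(** The vector X_(xi2, nu2, xi3, nu3) at [p]. *)
Definition frame (p : TTstarG) (c : (E * dual_space E) * (E * dual_space E)) :
    (E * dual_space E) * (E * dual_space E) :=
  let: ((g, mu), (xi, nu)) := p in
  let: ((xi2, nu2), (xi3, nu3)) := c in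
  ((right_field xi2 g, nu2 + ad_star xi2 mu),
   (xi3 + bracket xi xi2, nu3 + ad_star xi2 nu - ad_star xi nu2)).

(** The coordinates of [W] in [frame p], see [frameK] and [coframeK]. *)
Definition coframe (p : TTstarG) (W : (E * dual_space E) * (E * dual_space E)) :
    (E * dual_space E) * (E * dual_space E) :=
  let: ((g, mu), (xi, nu)) := p in
  let xi2 := right_triv g W.1.1 in
  let nu2 := W.1.2 - ad_star xi2 mu in
  ((xi2, nu2),
   (W.2.1 - bracket xi xi2, W.2.2 - ad_star xi2 nu + ad_star xi nu2)).

Lemma frameK (p : TTstarG) : cancel (frame p) (coframe p).
Proof.
case: p => -[g mu] [xi nu] [[xi2 nu2] [xi3 nu3]] /=.
rewrite right_fieldK; move: (ad_star xi2 mu) (bracket xi xi2) (ad_star xi2 nu).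
move=> a b c; rewrite (addrK a nu2) (addrK b xi3); move: (ad_star xi nu2) => d.
by rewrite (addrAC (nu3 + c - d)) (subrK d) (addrK c).
Qed.

Lemma coframeK (p : TTstarG) : cancel (coframe p) (frame p).
Proof.
case: p => -[g mu] [xi nu] [[Wg Wmu] [Wxi Wnu]] /=.
rewrite right_trivK; move: (right_triv g Wg) => xi2.
move: (ad_star xi2 mu) (bracket xi xi2) (ad_star xi2 nu) => a b c.
rewrite (subrK a) (subrK b); move: (ad_star xi (Wmu - a)) => d.
by rewrite (addrAC (Wnu - c)) (subrK c) (addrK d).
Qed.

Definition theta1 (p : TTstarG) (W : (E * dual_space E) * (E * dual_space E)) : R :=
  let: ((g, mu), (xi, nu)) := p in
  let: ((xi2, nu2), (xi3, nu3)) := coframe p W in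
  nu xi2 - nu2 xi + mu (bracket xi xi2).

Lemma theta1_frame g mu xi nu xi2 nu2 xi3 nu3 :
  let p : TTstarG := ((g, mu), (xi, nu)) in
  theta1 p (frame p ((xi2, nu2), (xi3, nu3))) =
  nu xi2 - nu2 xi + mu (bracket xi xi2).
Proof. by move=> p; rewrite {1}/theta1 /p frameK. Qed.

Definition Omega := exterior_derivative theta1.

Definition delta_g (H : TstarG -> R) (q : TstarG) : dual_space E :=
  to_dual (differential (M := G) (fun g => H (g, q.2)) q.1).

(** The derivative of [H] along the fibre is an element of the bidual of [E];
    [delta_mu] is the element of [E] which represents it, see [delta_muE]. *)
Definition delta_mu (H : TstarG -> R) (q : TstarG) : E :=
  xget 0 [set xi | forall beta : dual_space E,
    differential (M := vec_mfd (dual_space E)) (fun mu => H (q.1, mu)) q.2 beta =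
    beta xi].

End LieGroup.

Lemma pair_continuous (T T1 T2 : topologicalType) (f : T -> T1) (g : T -> T2)
    (x : T) : {for x, continuous f} -> {for x, continuous g} ->
  {for x, continuous (fun y => (f y, g y))}.
Proof. by move=> cf cg; apply: cvg_pair; [exact: cf|exact: cg]. Qed.

Section BracketContinuous.
Context {R : realType} {E : completeNormedModType R} (G : lieGroup E).

Let e : G := lie_one G.
Let x0 : E := chart_at e e.
Let m : E * E -> E := local_rep (M := prod_mfd G G) (N := G)
  (fun p : G * G => right_mul p.2 p.1) (e, e).
Let D (p : (E * E) * (E * E)) : E := 'd m (p.1) p.2.
Let A (xi x : E) : (E * E) * (E * E) := ((x0, x), (xi, 0)).

Lemma mul_rep_smooth : exists U : set (E * E),
  [/\ open U, U (x0, x0) & smooth_on U m].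
Proof.
have [_ [U [oU Ux sU]]] := @lie_mul_smooth R E G (e, e).
by exists U; split.
Qed.

Lemma chart_differentiable_at (q : G) : chart_dom (chart_at e) q ->
  differentiable_at (N := vec_mfd E) (chart_at e : G -> E) q.
Proof.
move=> dq; have [cM dM tM] := manifold_atlas G.
have [_ _ _ ce _] := cM e.
split; first exact: ce.
have [dt _] := tM q e 1%N; apply: dt; split; first by exists q => //; exact: dM.
by have := dq; rewrite -{1}(chart_atK (chart_at_dom q)).
Qed.

Lemma right_field_rep (xi : E) :
  \forall x \near x0, D (A xi x) = field_rep (right_field (G := G) xi) e x.
Proof.
have [U [oU Ux sU]] := mul_rep_smooth.
have nU : \forall x \near x0, U (x0, x).
  have cx : {for x0, continuous (fun x : E => (x0, x))}.
    by apply: cvg_pair; [exact: cvg_cst|exact: cvg_id].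
  by apply: cx; exact: open_nbhs_nbhs.
have nd : \forall x \near x0, chart_dom (chart_at e) (chart_inv (chart_at e) x).
  exact: near_chart_inv (near_chart_dom e).
apply: filterS3 nU nd (near_chart_cod e) => x Ux' dx _.
have [dm _] := sU 1%N.
have dmx : differentiable m (x0, x) by exact: dm.
rewrite /field_rep; set p := chart_inv (chart_at e) x.
have pe : right_mul p e = p by rewrite /right_mul /e /lie_one mul1g.
have dce : differentiable_at (N := vec_mfd E) (chart_at e : G -> E)
    (right_mul p e).
  by rewrite pe; exact: chart_differentiable_at.
have [_] := tangent_map_comp (right_mul_differentiable p e) dce.
move=> /(congr1 (@^~ xi)) /=; rewrite pe /right_field -/e => <-.
have -> : tangent_map (N := vec_mfd E) ((chart_at e : G -> E) \o right_mul p) e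
    = 'd (m \o (fun y => (y, x))) x0.
  rewrite /tangent_map; congr (GRing.Linear.sort ('d _ _)).
  apply/funext => y; rewrite /m /local_rep /=.
  rewrite -[RHS]/(chart_at (right_mul e e) (right_mul p (chart_inv (chart_at e) y))).
  by rewrite /right_mul /e /lie_one mulg1.
have dx' : differentiable (fun y : E => (y, x)) x0.
  by apply: differentiable_pair.
rewrite (diff_comp dx' dmx) /= /D /A /=; congr ('d _ _ _).
by rewrite diff_pair// diff_cst; congr pair; rewrite diff_val.
Qed.

Lemma D_differentiable (xi : E) : differentiable D (A xi x0).
Proof.
have [U [oU Ux sU]] := mul_rep_smooth.
by have [_ [dD _]] := sU 2%N; exact: dD.
Qed.

Lemma diff_A (xi x : E) :
  differentiable (A xi) x /\ forall eta, 'd (A xi) x eta = ((0, eta), (0, 0)).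
Proof.
have d1 : differentiable (fun y : E => (x0, y)) x by exact: differentiable_pair.
have d2 : differentiable (fun y : E => (xi, 0 : E)) x by exact: differentiable_cst.
split; first exact: differentiable_pair.
move=> eta; apply: (etrans (congr1 (@^~ eta) (diff_pair d1 d2))) => /=.
have dc : differentiable (cst x0 : E -> E) x by exact: differentiable_cst.
have di : differentiable (@id E) x by exact: ex_diff.
have hc : 'd (cst x0 : E -> E) x eta = 0 by rewrite diff_cst.
have hi : 'd (@id E) x eta = eta.
  by have H : 'd (@id E) x = id :> (E -> E) by [exact: diff_val]; rewrite H.
have h1 : 'd (fun y : E => (x0, y)) x eta = (0, eta).
  apply: (etrans (congr1 (@^~ eta) (diff_pair dc di))).
  exact: congr2 hc hi.
have h2 : 'd (fun _ : E => (xi, 0 : E)) x eta = 0 by rewrite diff_cst.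
exact: congr2 h1 h2.
Qed.

Lemma diff_field_rep (xi eta : E) :
  'd (field_rep (right_field (G := G) xi) e) x0 eta =
  'd D (A xi x0) ((0, eta), (0, 0)).
Proof.
have [dA dAE] := diff_A xi x0.
have dDA := differentiable_comp dA (D_differentiable xi).
have [_ ->] := near_eq_diff (right_field_rep xi) dDA.
by rewrite (diff_comp dA (D_differentiable xi)) /= dAE.
Qed.

Lemma bracketE (xi eta : E) : bracket G xi eta =
  'd D (A eta x0) ((0, D (A xi x0)), (0, 0)) -
  'd D (A xi x0) ((0, D (A eta x0)), (0, 0)).
Proof.
rewrite /bracket /jacobi_lie !diff_field_rep.
by rewrite -!(nbhs_singleton (right_field_rep _)).
Qed.

Lemma bracket_linear (xi : E) : linear (bracket G xi).
Proof.
have DA a u v x : D (A (a *: u + v) x) = a *: D (A u x) + D (A v x).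
  rewrite /D -linearP; congr ('d _ _ _).
  by congr pair; rewrite /= scaler0 addr0.
move=> a u v; rewrite !bracketE scalerBr addrACA -opprD; congr (_ - _); last first.
  rewrite -linearP; congr ('d _ _ _); rewrite DA.
  by congr ((_, _), (_, _)); rewrite /= ?scaler0 ?addr0.
set w := D (A xi x0).
suff key : 'd (field_rep (right_field (G := G) (a *: u + v)) e) x0 w =
    a *: 'd (field_rep (right_field (G := G) u) e) x0 w +
    'd (field_rep (right_field (G := G) v) e) x0 w.
  exact: etrans (esym (diff_field_rep _ w)) (etrans key
    (congr2 (fun s t => a *: s + t) (diff_field_rep u w) (diff_field_rep v w))).
have dr z := (near_eq_diff (right_field_rep z)
  (differentiable_comp (diff_A z x0).1 (D_differentiable z))).1.
set Xu := field_rep (right_field (G := G) u) e.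
set Xv := field_rep (right_field (G := G) v) e.
set Xw := field_rep (right_field (G := G) (a *: u + v)) e.
have du : differentiable Xu x0 by exact: dr.
have dv : differentiable Xv x0 by exact: dr.
have daw : differentiable (a *: Xu) x0 by exact: differentiableZ.
have XE : \forall x \near x0, (a *: Xu + Xv) x = Xw x.
  near=> x; rewrite -[LHS]/(a *: Xu x + Xv x).
  have <- : D (A (a *: u + v) x) = Xw x by near: x; exact: right_field_rep.
  have <- : D (A u x) = Xu x by near: x; exact: right_field_rep.
  have <- : D (A v x) = Xv x by near: x; exact: right_field_rep.
  by rewrite DA.
have dE := (near_eq_diff XE (differentiableD daw dv)).2.
apply: (etrans (congr1 (@^~ w) dE)).
apply: (etrans (congr1 (@^~ w) (diffD daw dv))).
exact: (congr1 (fun h => h w + 'd Xv x0 w) (diffZ a du)).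
Unshelve. all: by end_near. Qed.

Lemma bracket_continuous (xi : E) : continuous (bracket G xi).
Proof.
have [U [oU Ux sU]] := mul_rep_smooth.
have [_ [_ cD2]] := sU 2%N.
have cA : continuous (fun eta => A eta x0).
  move=> eta; apply: (@pair_continuous _ _ _ (fun=> (x0, x0))
    (fun y => (y, 0)) eta); first exact: cvg_cst.
  by apply: pair_continuous; [exact: cvg_id|exact: cvg_cst].
have c1 w : continuous (fun eta => 'd D (A eta x0) ((0, w), (0, 0))).
  move=> eta.
  apply: (@continuous_comp _ _ _ (fun eta => (A eta x0, ((0, w), (0, 0))))
    (fun P => 'd D (P.1) P.2) eta); last by apply: cD2.
  by apply: pair_continuous; [exact: cA|exact: cvg_cst].
have c2 : continuous (fun eta => 'd D (A xi x0) ((0, D (A eta x0)), (0, 0))).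
  move=> eta.
  apply: (@continuous_comp _ _ _ (fun eta => ((0, D (A eta x0)), (0, 0)))
    ('d D (A xi x0)) eta).
    apply: pair_continuous; last exact: cvg_cst.
    apply: pair_continuous; first exact: cvg_cst.
    apply: (@continuous_comp _ _ _ (fun eta => (eta, 0)) ('d m (x0, x0)) eta).
      by apply: pair_continuous; [exact: cvg_id|exact: cvg_cst].
    by apply: diff_continuous; have [+ _] := sU 1%N; apply.
  by apply: diff_continuous; exact: D_differentiable.
move=> eta; rewrite (_ : bracket G xi = fun eta =>
  'd D (A eta x0) ((0, D (A xi x0)), (0, 0)) -
  'd D (A xi x0) ((0, D (A eta x0)), (0, 0))).
  exact: (continuousB (c1 (D (A xi x0)) eta) (c2 eta)).
by apply/funext => z; exact: bracketE.
Qed.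

Lemma ad_starE (xi : E) (mu : dual_space E) (eta : E) :
  ad_star G xi mu eta = mu (bracket G xi eta).
Proof.
rewrite /ad_star to_dualE//.
  by move=> a x y; rewrite bracket_linear linearP.
move=> x; apply: continuous_comp; first exact: bracket_continuous.
by have [_] := dualP mu; exact.
Qed.

End BracketContinuous.

Section WellDefined.
Context {R : realType} {E : completeNormedModType R} (G : lieGroup E).

Lemma right_cotrivE (g : G) (alpha : dual_space E) (xi : E) :
  right_cotriv g alpha xi = alpha (right_field xi g).
Proof.
have [_ df] := right_mul_differentiable g (lie_one G).
rewrite /right_cotriv to_dualE//.
  by move=> a x y; rewrite /right_field /tangent_map !linearP.
have crf : continuous (fun xi => right_field (G := G) xi g).
  exact: (diff_continuous df).
have [_ ca] := dualP alpha.
by move=> x; exact: (continuous_comp (crf x) (ca _)).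
Qed.

Context (H : TstarG G -> R).
Context (smoothH : smooth_map (M := TstarG G) (N := vec_mfd R) H).

Lemma delta_gE (q : TstarG G) (V : E) :
  delta_g H q V = differential (M := G) (fun g => H (g, q.2)) q.1 V.
Proof.
have [_ dH] := smooth_differentiable_at (smoothH q).
have d : differentiable (local_rep (M := G) (N := vec_mfd R)
    (fun g => H (g, q.2)) q.1) (chart_at q.1 q.1).
  have -> : local_rep (M := G) (N := vec_mfd R) (fun g => H (g, q.2)) q.1 =
      local_rep (M := TstarG G) (N := vec_mfd R) H q \o (fun x => (x, q.2)).
    by apply/funext.
  by apply: differentiable_comp; first exact: differentiable_pair.
rewrite /delta_g to_dualE//.
  by move=> a x y; rewrite /differential /tangent_map linearP.
exact: diff_continuous.
Qed.

Lemma delta_muE (q : TstarG G) (beta : dual_space E) : reflexive_space E ->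
  differential (M := vec_mfd (dual_space E)) (fun mu => H (q.1, mu)) q.2 beta =
  beta (delta_mu H q).
Proof.
move=> reflE; have [_ dH] := smooth_differentiable_at (smoothH q).
have d : differentiable (local_rep (M := vec_mfd (dual_space E)) (N := vec_mfd R)
    (fun mu => H (q.1, mu)) q.2) q.2.
  have -> : local_rep (M := vec_mfd (dual_space E)) (N := vec_mfd R)
      (fun mu => H (q.1, mu)) q.2 =
      local_rep (M := TstarG G) (N := vec_mfd R) H q \o
      (fun x => (chart_at q.1 q.1, x)).
    apply/funext => x; rewrite -[RHS]/(H
      (chart_inv (chart_at q.1) (chart_at q.1 q.1), x)).
    by rewrite chart_atK//; exact: chart_at_dom.
  by apply: differentiable_comp; first exact: differentiable_pair.
have [xi xiE] := reflE (to_dual (differential (M := vec_mfd (dual_space E))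
  (fun mu => H (q.1, mu)) q.2)).
have : exists xi, forall beta : dual_space E, differential (M := vec_mfd (dual_space E))
    (fun mu => H (q.1, mu)) q.2 beta = beta xi.
  exists xi => b; rewrite -xiE to_dualE//.
    by move=> a x y; rewrite /differential /tangent_map linearP.
  exact: diff_continuous.
by move=> [x]; rewrite /delta_mu; case: xgetP => [z _ + _|/[swap]]; [exact|by move=> + /(_ x)].
Qed.

End WellDefined.

(* Main.v *)
Require Import Defs.
From HB Require Import structures.
From mathcomp Require Import all_boot all_order all_algebra.
From mathcomp Require Import all_classical all_reals all_analysis.
From mathcomp Require Import ring lra.
Set Implicit Arguments.
Unset Strict Implicit.
Unset Printing Implicit Defensive.
Import Order.TTheory GRing.Theory Num.Theory.
Import numFieldNormedType.Exports.
Local Open Scope classical_set_scope.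
Local Open Scope ring_scope.

(** Write a tangent vector at [((g, mu), (xi, nu))] as [W], with base component
    [(V_g, V_mu)]. In the definition of [theta1] the two bracket terms cancel, and
    [theta1] takes the value [nu xi2 - V_mu xi] at [W], where [xi2] is [V_g] in the
    right trivialization ([theta1E]). So [theta1] is the nondegenerate [pairing] of
    [(xi, nu)] with the trivialized base component, and the equation
    [- tau^* dH = theta1] has exactly one solution over each point of [TstarG G]:
    [S'] is the graph of the section [(delta H / delta mu, - T_e^* R_g (delta H /
    delta g))] ([theta1_graphE]). Read through [trivialize], this already gives
    Hamilton's equations, one instant at a time.

    The graph of a smooth section is a submanifold. The section is [- dH], in the
    right trivialization, composed with the inverse of the pairing. That inverse
    exists because [E] is reflexive, and it is bounded by the Hahn-Banach theorem
    ([pairing_inverse]). Smoothness of [dH] as a map to a dual space with its norm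
    is not immediate, since smoothness of [H] means continuity of the iterated
    tangent maps jointly in points and vectors; [transpose_smooth] bridges the gap,
    bounding the remainder of the first-order expansion by means of a local bound
    on the next derivative.

    For the Lagrangian property ([graph_lagrangian]), let [u] be any vector at a
    point of [S'] and [v] be tangent to [S']. Along [S'] the form [theta1] equals
    [- tau^* dH], whose derivatives along [S'] are second derivatives of [H]. These
    are symmetric ([second_diff_symmetric]) and cancel in [Omega u v]. There remains
    the pairing of the vertical deviation of [u] from the tangent space of [S'] with
    the base component of [v], and it vanishes for all [v] if and only if [u] is
    tangent to [S']. *)

(** * The Hahn-Banach theorem *)

Section HahnBanach.
Context {R : realType} {E : normedModType R}.
Implicit Types (p q : E -> R) (x y : E).

Definition sublinear q : Prop :=
  (forall x y, q (x + y) <= q x + q y) /\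
  (forall (a : R) x, 0 <= a -> q (a *: x) <= a * q x).

Lemma sublinear0 q : sublinear q -> q 0 = 0.
Proof.
move=> [qD qZ]; apply/eqP; rewrite eq_le.
have := qZ 0 0 (lexx 0); rewrite scale0r mul0r => -> /=.
by have := qD 0 0; rewrite addr0; lra.
Qed.

Lemma sublinear_ge q x : sublinear q -> - q (- x) <= q x.
Proof.
move=> sq; have [qD _] := sq.
by have := qD x (- x); rewrite subrr (sublinear0 sq); lra.
Qed.

Lemma sublinearZ q (a : R) x : sublinear q -> 0 <= a -> q (a *: x) = a * q x.
Proof.
move=> sq a0; have [_ qZ] := sq.
have [->|an0] := eqVneq a 0; first by rewrite scale0r mul0r sublinear0.
have a1 : 0 < a by rewrite lt_def an0.
apply/eqP; rewrite eq_le (qZ _ _ a0) /= -ler_pdivlMl//.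
have ai : 0 <= a^-1 by rewrite invr_ge0.
by have := qZ a^-1 (a *: x) ai; rewrite scalerK.
Qed.

Lemma inf_le_of (A : set R) (b c : R) :
  (forall z, A z -> c <= z) -> A b -> inf A <= b.
Proof. by move=> Ac Ab; apply: ge_inf => //; exists c. Qed.

(** Of two members of a chain one is the smaller at both points, and it witnesses
    the subadditivity of the infimum. *)
Lemma chain_inf_sublinear p (A : set (E -> R)) : A !=set0 ->
  (forall q, A q -> sublinear q /\ forall x, q x <= p x) ->
  (forall q r, A q -> A r ->
     (forall x, q x <= r x) \/ (forall x, r x <= q x)) ->
  let m x := inf [set q x | q in A] in
  [/\ sublinear m, forall x, m x <= p x &
      forall q, A q -> forall x, m x <= q x].
Proof.
move=> [q0 Aq0] Asub Atot m.
have lb x z : [set q x | q in A] z -> - p (- x) <= z.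
  move=> [q Aq <-]; have [sq qp] := Asub q Aq.
  by rewrite (le_trans _ (sublinear_ge x sq))// lerN2.
have mle q x : A q -> m x <= q x by move=> Aq; apply: inf_le_of (lb x) _; exists q.
have ne x : [set q x | q in A] !=set0 by exists (q0 x); exists q0.
split; last 2 first.
- by move=> x; rewrite (le_trans (mle _ _ Aq0))//; case: (Asub q0 Aq0).
- by move=> q Aq x; exact: mle.
split=> [x y|a x].
  rewrite -lerBlDr; apply: lb_le_inf => // _ [q Aq <-].
  rewrite lerBlDr -lerBlDl; apply: lb_le_inf => // _ [r Ar <-]; rewrite lerBlDl.
  have [qr|rq] := Atot q r Aq Ar.
  - have [[qD _] _] := Asub q Aq.
    by rewrite (le_trans (mle q _ Aq))// (le_trans (qD _ _))// lerD2l.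
  - have [[rD _] _] := Asub r Ar.
    by rewrite (le_trans (mle r _ Ar))// (le_trans (rD _ _))// lerD2r.
rewrite le_eqVlt => /predU1P[<-|a0].
  have [sq _] := Asub _ Aq0.
  by rewrite scale0r mul0r (le_trans (mle q0 _ Aq0))// sublinear0.
rewrite -ler_pdivrMl//; apply: lb_le_inf => // _ [q Aq <-].
rewrite ler_pdivrMl// (le_trans (mle q _ Aq))//.
by have [[_ qZ] _] := Asub q Aq; rewrite qZ// ltW.
Qed.

Lemma minimal_sublinear p : sublinear p -> exists f,
  [/\ sublinear f, forall x, f x <= p x &
      forall q, sublinear q -> (forall x, q x <= f x) -> q = f].
Proof.
move=> sp; pose T := {q : E -> R | sublinear q /\ forall x, q x <= p x}.
pose below (s t : T) := `[< forall x, sval t x <= sval s x >].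
have [||||f fmin] := @Zorn T below.
- by move=> t; apply/asboolP.
- move=> r s t /asboolP sr /asboolP ts; apply/asboolP => x.
  exact: le_trans (ts x) (sr x).
- move=> [s Ps] [t Pt] /asboolP /= ts /asboolP /= st; apply: eq_exist.
  by apply/funext => x; apply/eqP; rewrite eq_le st ts.
- move=> A Atot; have [[q0 Aq0]|A0] := pselect (A !=set0); last first.
    exists (exist _ p (conj sp (fun x => lexx _))) => s As.
    by exfalso; apply: A0; exists s.
  have [|||sm mp mA] := @chain_inf_sublinear p [set sval t | t in A].
  + by exists (sval q0); exists q0.
  + by move=> _ [t _ <-]; exact: (svalP t).
  + move=> _ _ [s As <-] [t At <-].
    by have [/asboolP|/asboolP] := Atot s t As At; [right|left].
  pose m x := inf [set q x | q in [set sval t | t in A]].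
  have Pm : sublinear m /\ forall x, m x <= p x by [].
  exists (exist _ m Pm : T) => s As; apply/asboolP => x /=.
  by apply: mA; exists s.
case: f fmin => f [sf fp] fmin; exists f; split=> // q sq qf.
have qp x : q x <= p x by exact: le_trans (qf x) (fp x).
have /(congr1 sval) := fmin (exist _ q (conj sq qp)) (asboolT qf); exact.
Qed.

(** The largest sublinear function below [q] whose value at [- y] is at most
    [- q y]. *)
Definition lower_along q y x : R :=
  inf [set q (x + t *: y) - t * q y | t in [set t : R | 0 <= t]].

Lemma lower_along_sublinear q y : sublinear q ->
  [/\ sublinear (lower_along q y), forall x, lower_along q y x <= q x &
      lower_along q y (- y) <= - q y].
Proof.
move=> sq; have [qD qZ] := sq; set m := lower_along q y.
have lb x z : [set q (x + t *: y) - t * q y | t in [set t : R | 0 <= t]] z ->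
    - q (- x) <= z.
  move=> [t /= t0 <-]; rewrite -(sublinearZ y sq t0).
  by have := qD (- x) (x + t *: y); rewrite addKr; lra.
have mle x t : 0 <= t -> m x <= q (x + t *: y) - t * q y.
  by move=> t0; apply: inf_le_of (lb x) _; exists t.
have ne x : [set q (x + t *: y) - t * q y | t in [set t : R | 0 <= t]] !=set0.
  by exists (q (x + 0 *: y) - 0 * q y); exists 0 => /=.
have mq x : m x <= q x.
  by have := mle x 0 (lexx 0); rewrite scale0r addr0 mul0r subr0.
split=> //; last first.
  have := mle (- y) 1 ler01; rewrite scale1r addNr sublinear0// mul1r.
  by rewrite sub0r.
split=> [x z|a x].
  rewrite -lerBlDr; apply: lb_le_inf => // _ [s /= s0 <-].
  rewrite lerBlDr -lerBlDl; apply: lb_le_inf => // _ [t /= t0 <-].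
  have := mle (x + z) (s + t) (addr_ge0 s0 t0).
  have := qD (x + s *: y) (z + t *: y).
  by rewrite addrACA -scalerDl mulrDl; lra.
rewrite le_eqVlt => /predU1P[<-|a0].
  by rewrite scale0r mul0r (le_trans (mq 0))// sublinear0.
rewrite -ler_pdivrMl//; apply: lb_le_inf => // _ [t /= t0 <-].
rewrite ler_pdivrMl// (le_trans (mle _ (a * t) (mulr_ge0 (ltW a0) t0)))//.
by rewrite -scalerA -scalerDr (sublinearZ _ sq (ltW a0)) mulrBr mulrA.
Qed.

(** By minimality [f = lower_along f y] for every [y], so that
    [f (- y) <= - f y]: thus [f] is odd, and a sublinear odd function is linear. *)
Lemma minimal_sublinear_linear f : sublinear f ->
  (forall q, sublinear q -> (forall x, q x <= f x) -> q = f) ->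
  forall (a : R) x y, f (a *: x + y) = a * f x + f y.
Proof.
move=> sf fmin; have [fD fZ] := sf.
have fN x : f (- x) = - f x.
  have [sl lf lN] := lower_along_sublinear x sf.
  have := sublinear_ge x sf; move: lN; rewrite (fmin _ sl lf) => ? ?.
  by apply/eqP; rewrite eq_le; apply/andP; split=> //; rewrite lerNl.
have fDE x y : f (x + y) = f x + f y.
  apply/eqP; rewrite eq_le fD /=.
  by have := fD (- x) (- y); rewrite -opprD !fN -opprD lerN2.
have fZE (a : R) x : f (a *: x) = a * f x.
  have [a0|a0] := lerP 0 a; first exact: sublinearZ.
  have na : 0 <= - a by rewrite oppr_ge0 ltW.
  by rewrite -[a]opprK scaleNr fN (sublinearZ x sf na) [RHS]mulNr.
by move=> a x y; rewrite fDE fZE.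
Qed.

Lemma norm_sublinear : sublinear (fun x : E => `|x|).
Proof.
split=> [x y|a x a0]; first exact: ler_normD.
by rewrite normrZ ger0_norm.
Qed.

Lemma ler_dual_norm (f : dual_space E) x : `|f x| <= `|f| * `|x|.
Proof.
have [->|x0] := eqVneq x 0; first by rewrite linear0 !normr0 mulr0.
have nx : 0 < `|x| by rewrite normr_gt0.
have xi : `|x|^-1 = `| `|x|^-1 | by rewrite normfV normr_id.
rewrite -ler_pdivrMr// mulrC {1}xi -normrM.
rewrite -[_ * f x]/(_ *: f x) -linearZ.
apply: (sup_upper_bound (has_sup_unit_values f)).
by exists (`|x|^-1 *: x) => //=; rewrite normrZ normfV normr_id mulVf ?gt_eqF.
Qed.

Lemma dual_norm_le (f : dual_space E) (C : R) : 0 <= C ->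
  (forall x, `|f x| <= C * `|x|) -> `|f| <= C.
Proof.
move=> C0 fC; apply: ge_sup; first by case: (has_sup_unit_values f).
by move=> _ [x /= x1 <-]; rewrite (le_trans (fC x))// ler_piMr.
Qed.

(** The Hahn-Banach theorem: a minimal sublinear function below the norm is
    linear, and lowering the norm along [x] beforehand forces the value [`|x|] at
    [x]. *)
Lemma norming_functional x : exists2 f : dual_space E, `|f| <= 1 & f x = `|x|.
Proof.
have [sl ln lN] := lower_along_sublinear x norm_sublinear.
have [f [sf fl fmin]] := minimal_sublinear sl.
have flin := minimal_sublinear_linear sf fmin.
have fn z : f z <= `|z| := le_trans (fl z) (ln z).
have f0 : f 0 = 0 := sublinear0 sf.
have fN z : f (- z) = - f z.
  by have := flin (-1) z 0; rewrite addr0 f0 addr0 scaleN1r mulN1r.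
have fabs z : `|f z| <= `|z|.
  by rewrite ler_norml fn andbT lerNl -fN -(normrN z) fn.
have cf : continuous f.
  have linf : linear f by [].
  pose fm := GRing.isLinear.Build _ _ _ _ _ linf.
  pose fL : {linear E -> R} := HB.pack f fm.
  have : bounded_near fL (nbhs (0 : E)).
    apply/linear_boundedP; near=> r => z; rewrite (le_trans (fabs z))//.
    by rewrite ler_peMl.
  by move=> /linear_bounded_continuous.
exists (to_dual f).
  apply: dual_norm_le => // z; rewrite to_dualE// mul1r; exact: fabs.
rewrite to_dualE//; apply/eqP; rewrite eq_le fn /=.
by have := le_trans (fl (- x)) lN; rewrite fN lerN2.
Unshelve. all: by end_near. Qed.

Lemma dual_separates x y : (forall f : dual_space E, f x = f y) -> x = y.
Proof.
move=> xy; have [f _ fxy] := norming_functional (x - y).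
by apply/eqP; rewrite -subr_eq0 -normr_eq0 -fxy linearB /= xy subrr.
Qed.

End HahnBanach.

(** * Differential calculus *)

Section Calculus.
Context {R : realType}.
Implicit Types E F V W : normedModType R.

Lemma ball_normP E (x y : E) (r : R) : ball x r y <-> `|y - x| < r.
Proof. by rewrite -ball_normE /= distrC. Qed.

Lemma differentiable_of_remainder E F (f : E -> F) (L : {linear E -> F}) (x : E) :
  continuous L ->
  (forall e : R, 0 < e ->
     \forall h \near (0 : E), `|f (h + x) - f x - L h| <= e * `|h|) ->
  differentiable f x /\ 'd f x = L :> (E -> F).
Proof.
move=> cL fL; have key : f \o shift x = cst (f x) + L +o_ 0 id.
  apply/eqaddoP => e e0; apply: filterS (fL e e0) => h.
  by rewrite /= !fctE /= opprD addrA.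
have dE : 'd f x = L :> (E -> F) by apply: diff_unique.
by split=> //; apply/diff_locallyP; rewrite dE.
Qed.

Lemma line_diff E (x h : E) (t : R) :
  differentiable (fun s : R => x + s *: h) t /\
  forall s, 'd (fun s : R => x + s *: h) t s = s *: h.
Proof.
have d1 : is_diff t (fun s : R => x + s *: h) (0 + (fun s => s *: h)).
  exact: is_diffD.
by split=> [|s]; [exact: ex_diff|rewrite diff_val /= add0r].
Qed.

Lemma mean_value E (f : E -> R) (x h : E) :
  (forall t : R, 0 <= t <= 1 -> differentiable f (x + t *: h)) ->
  exists2 t : R, 0 <= t <= 1 & f (x + h) - f x = 'd f (x + t *: h) h.
Proof.
move=> df; pose g (t : R) := f (x + t *: h).
have dg (t : R) : 0 <= t <= 1 -> is_derive t 1 g ('d f (x + t *: h) h).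
  move=> t01; have [dl lE] := line_diff x h t.
  have dfl : differentiable g t := differentiable_comp dl (df t t01).
  apply: DeriveDef; first exact: diff_derivable.
  by rewrite deriveE// (diff_comp dl (df t t01)) /= lE scale1r.
have [||t t01 gt] := @MVT_segment R g (fun t => 'd f (x + t *: h) h) 0 1 ler01.
- by move=> t; rewrite in_itv/= => /andP[t0 t1]; apply: dg; rewrite !ltW.
- apply: derivable_within_continuous => t; rewrite in_itv /= => t01.
  by have [] := dg t t01.
exists t; first by move: t01; rewrite in_itv.
by move: gt; rewrite /g scale1r scale0r addr0 subr0 mulr1.
Qed.

Lemma ball_segment E (x y h : E) (r t : R) : 0 <= t <= 1 ->
  ball x r y -> ball x r (y + h) -> ball x r (y + t *: h).
Proof.
move=> /andP[t0 t1] /ball_normP yr /ball_normP hr; apply/ball_normP.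
have -> : y + t *: h - x = (1 - t) *: (y - x) + t *: (y + h - x).
  by rewrite [y + h - x]addrAC (scalerDr t (y - x)) addrA -scalerDl subrK scale1r addrAC.
rewrite (le_lt_trans (ler_normD _ _))// !normrZ ger0_norm ?subr_ge0// ger0_norm//.
have [->|tn0] := eqVneq t 0; first by rewrite subr0 mul1r mul0r addr0.
have tp : 0 < t by rewrite lt_def tn0.
have : (1 - t) * `|y - x| <= (1 - t) * r by rewrite ler_wpM2l ?subr_ge0// ltW.
have : t * `|y + h - x| < t * r by rewrite ltr_pM2l.
by nra.
Qed.

Lemma CnS n E F (U : set E) (f : E -> F) : Cn n.+1 U f -> Cn n U f.
Proof.
elim: n E F U f => [|n IH] E F U f [df Cf].
  by move=> x Ux; apply: differentiable_continuous; exact: df.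
by split=> //; exact: IH.
Qed.

Lemma Cn_sub n E F (U U' : set E) (f : E -> F) : U' `<=` U -> Cn n U f -> Cn n U' f.
Proof.
elim: n E F U U' f => [|n IH] E F U U' f UU /=; first by move=> cf x /UU; exact: cf.
move=> [df Cf]; split; first by move=> x /UU; exact: df.
by apply: IH Cf => -[x v] [/= /UU].
Qed.

(** The tangent map of [g \o f] is the tangent map of [g] composed with
    [(x, v) |-> (f x, 'd f x v)], to which the induction hypothesis applies. *)
Lemma Cn_comp n E F V (U : set E) (W : set F) (f : E -> F) (g : F -> V) :
  open U -> open W -> (forall x, U x -> W (f x)) ->
  Cn n U f -> Cn n W g -> Cn n U (g \o f).
Proof.
elim: n E F V U W f g => [|n IH] E F V U W f g oU oW UW.
  move=> cf cg x Ux; apply: continuous_comp; first exact: cf.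
  by apply: cg; exact: UW.
move=> Cf [dg Cg]; have [df Cf'] := Cf.
split; first by move=> x Ux; apply: differentiable_comp; [exact: df|exact/dg/UW].
have oUT : open (U `*` [set: E]) by exact: openX openT.
have oWT : open (W `*` [set: F]) by exact: openX openT.
have Cf1 : Cn n (U `*` [set: E]) (f \o (fst : {linear (E * E)%type -> E})).
  apply: (Cn_comp_linear oUT oU) (CnS Cf); first by move=> p; exact: cvg_fst.
  by move=> p [].
have := IH _ _ _ _ _ _ _ oUT oWT _ (Cn_pair oUT Cf1 Cf') Cg.
move=> /(_ _)/Cn_eq; apply=> //; last by move=> [x v] [/= /UW].
by move=> [x v] [/= Ux _]; rewrite (diff_comp (df x Ux) (dg _ (UW _ Ux))).
Qed.

Lemma diff_slice1 E V F (f : E * V -> F) (x : E) (v : V) : differentiable f (x, v) ->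
  differentiable (fun y => f (y, v)) x /\
  forall h, 'd (fun y => f (y, v)) x h = 'd f (x, v) (h, 0).
Proof.
move=> df; have dx : differentiable (fun y : E => (y, v)) x.
  exact: differentiable_pair.
split=> [|h]; first exact: differentiable_comp dx df.
rewrite (diff_comp dx df) /=; congr ('d _ _ _).
by rewrite diff_pair// diff_cst; congr pair; rewrite diff_val.
Qed.

Lemma diff_slice2 E V F (f : E * V -> F) (x : E) (v : V) : differentiable f (x, v) ->
  differentiable (fun w => f (x, w)) v /\
  forall h, 'd (fun w => f (x, w)) v h = 'd f (x, v) (0, h).
Proof.
move=> df; have dx : differentiable (fun w : V => (x, w)) v.
  exact: differentiable_pair.
split=> [|h]; first exact: differentiable_comp dx df.
rewrite (diff_comp dx df) /=; congr ('d _ _ _).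
by rewrite diff_pair// diff_cst; congr pair; rewrite diff_val.
Qed.

Lemma fst_diff E F (x : E * F) :
  differentiable (fst : E * F -> E) x /\ 'd (fst : E * F -> E) x = fst :> (E * F -> E).
Proof.
have c : continuous (fst : {linear (E * F)%type -> E}) by move=> y; exact: cvg_fst.
by split; [exact: (linear_differentiable x c)|exact: (diff_lin x c)].
Qed.

Lemma snd_diff E F (x : E * F) :
  differentiable (snd : E * F -> F) x /\ 'd (snd : E * F -> F) x = snd :> (E * F -> F).
Proof.
have c : continuous (snd : {linear (E * F)%type -> F}) by move=> y; exact: cvg_snd.
by split; [exact: (linear_differentiable x c)|exact: (diff_lin x c)].
Qed.

Lemma diff_add_cst E F (f : E -> F) (x : E) (a : F) : differentiable f x ->
  'd (fun y => f y + a) x = 'd f x :> (E -> F).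
Proof.
move=> df; apply: (etrans (diffD df (differentiable_cst a x))).
by apply/funext => v; rewrite -[LHS]/('d f x v + 'd (cst a) x v) diff_cst /= addr0.
Qed.

End Calculus.

(** * Smoothness in the dual norm *)

Section Transpose.
Context {R : realType}.
Implicit Types E F V W : normedModType R.

Definition linear2_on E V (U : set E) (Phi : E * V -> R) : Prop :=
  forall x, U x -> forall (a : R) v w,
    Phi (x, a *: v + w) = a * Phi (x, v) + Phi (x, w).

Definition transpose E V (Phi : E * V -> R) (x : E) : dual_space V :=
  to_dual (fun v => Phi (x, v)).

(** The map [((x, h), v) |-> D_1 Phi (x, v) h]. The direction [h] joins the base
    point, so that the result is again a function which is linear in [v]. *)
Definition partial1 E V (Phi : E * V -> R) (q : (E * E) * V) : R :=
  'd Phi (q.1.1, q.2) (q.1.2, 0).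

(** Homogeneous estimates need to be checked on a ball only; [h = 0] is covered
    by [a = 0]. *)
Lemma rescale E (e : R) (h : E) : 0 < e ->
  exists (a : R) (k : E), [/\ h = a *: k, `|k| < e, 0 <= a & a <= 2 / e * `|h|].
Proof.
move=> e0; have [->|h0] := eqVneq h 0.
  by exists 0, 0; rewrite scale0r !normr0 mulr0.
have nh : 0 < `|h| by rewrite normr_gt0.
have a0 : 0 < 2 / e * `|h| by rewrite mulr_gt0// divr_gt0.
exists (2 / e * `|h|), ((2 / e * `|h|)^-1 *: h).
rewrite scalerKV ?gt_eqF// normrZ gtr0_norm ?invr_gt0// (ltW a0) lexx; split=> //.
have -> : (2 / e * `|h|)^-1 * `|h| = e / 2 by field; rewrite !gt_eqF.
by rewrite ltr_pdivrMr// ltr_pMr// ltr1n.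
Qed.

Lemma linear2_scale E V (U : set E) (Phi : E * V -> R) (x : E) : linear2_on U Phi ->
  U x -> forall a v, Phi (x, a *: v) = a * Phi (x, v).
Proof.
move=> lP Ux a v; have P0 : Phi (x, 0) = 0.
  by have := lP x Ux (-1) 0 0; rewrite scaler0 addr0 mulN1r addNr.
by rewrite -[a *: v]addr0 lP// P0 addr0.
Qed.

Section Bound.
Context (E V : normedModType R) (U : set E) (Phi : E * V -> R).
Context (oU : open U).
Context (lP : linear2_on U Phi).
Context (dP : forall q, (U `*` setT) q -> differentiable Phi q).

Lemma partial1_linear2 : linear2_on (U `*` setT) (partial1 Phi).
Proof.
move=> [x h] [/= Ux _] a v w; rewrite /partial1 /=.
have d1 z : differentiable Phi (x, z) by exact: dP.
rewrite -!(diff_slice1 (d1 _)).2.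
have dv := (diff_slice1 (d1 v)).1; have dw := (diff_slice1 (d1 w)).1.
have E1 : \forall y \near x, ((a *: fun y => Phi (y, v)) + fun y => Phi (y, w)) y
    = Phi (y, a *: v + w).
  have : nbhs x U by exact: open_nbhs_nbhs.
  by apply: filterS => y Uy; rewrite lP.
have [_ ->] := near_eq_diff E1 (differentiableD (differentiableZ a dv) dw).
apply: (etrans (congr1 (@^~ h) (diffD (differentiableZ a dv) dw))).
exact: (congr1 (fun f => f h + 'd (fun y => Phi (y, w)) x h) (diffZ a dv)).
Qed.

Lemma partial1_linear1 x v (a : R) h k :
  partial1 Phi ((x, a *: h + k), v) =
  a * partial1 Phi ((x, h), v) + partial1 Phi ((x, k), v).
Proof.
rewrite /partial1 /= -[a * _]/(a *: _) -linearP; congr ('d _ _ _).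
by congr pair; rewrite /= scaler0 addr0.
Qed.

Lemma partial1_scale1 x v (a : R) h :
  partial1 Phi ((x, a *: h), v) = a * partial1 Phi ((x, h), v).
Proof.
rewrite /partial1 /= -[a * _]/(a *: _) -linearZ; congr ('d _ _ _).
by congr pair; rewrite /= scaler0.
Qed.

(** A function which is continuous at the origin and bilinear is bounded by a
    multiple of the product of the norms, here locally uniformly in the base
    point. *)
Lemma partial1_bound x : U x -> {for ((x, 0), 0), continuous (partial1 Phi)} ->
  exists C r : R, [/\ 0 <= C, 0 < r, forall y, ball x r y -> U y &
    forall y h v, ball x r y -> `|partial1 Phi ((y, h), v)| <= C * `|h| * `|v|].
Proof.
move=> Ux cP; have P0 : partial1 Phi ((x, 0), 0) = 0.
  by rewrite -[X in (x, X)](scale0r (0 : E)) partial1_scale1 mul0r.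
have n1 : \forall q \near ((x, 0) : E * E, 0 : V), `|partial1 Phi q| < 1.
  have /(@cvgr_dist_lt _ _ _ _ _ _)/(_ 1 ltr01) := cP.
  by apply: filterS => q; rewrite P0 sub0r normrN.
have nU : nbhs x U by exact: open_nbhs_nbhs.
have /nbhs_ballP[r /= r0 rU] := nU.
have /nbhs_ballP[e /= e0 eP] := n1.
have ee : 0 < 2 / e by rewrite divr_gt0.
exists ((2 / e) ^+ 2), (Num.min r e).
split; [by rewrite sqr_ge0|by rewrite lt_min r0|..].
  by move=> y xy; apply: rU; apply: le_ball xy; rewrite ge_min lexx.
move=> y h v /[dup] xy' xy.
have Uy : U y by apply: rU; apply: le_ball xy; rewrite ge_min lexx.
have ye : ball x e y by apply: le_ball xy; rewrite ge_min lexx orbT.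
have [a [h' [-> h'e a0 ae]]] := rescale h e0.
have [b [v' [-> v'e b0 be]]] := rescale v e0.
rewrite partial1_scale1 (linear2_scale partial1_linear2)//.
have /eP/= /ltW P1 : ball ((x, 0), 0) e ((y, h'), v').
  by split; [split|] => //=; apply/ball_normP; rewrite subr0.
rewrite !normrM (ger0_norm a0) (ger0_norm b0) mulrA.
move: ae be; rewrite !normrZ (ger0_norm a0) (ger0_norm b0) => ae be.
apply: (@le_trans _ _ (a * b)); first by rewrite ler_piMr ?mulr_ge0.
apply: (le_trans (ler_pM a0 b0 ae be)); rewrite le_eqVlt; apply/orP; left.
by apply/eqP; ring.
Qed.

Lemma partial1_mean (x h : E) v (r : R) (c : E) :
  (forall y, ball c r y -> U y) -> ball c r x -> ball c r (x + h) ->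
  exists2 t : R, 0 <= t <= 1 &
    Phi (x + h, v) - Phi (x, v) = partial1 Phi ((x + t *: h, h), v).
Proof.
move=> cU cx ch.
have dl t : 0 <= t <= 1 -> differentiable Phi (x + t *: h, v).
  by move=> t01; apply: dP; split => //; apply: cU; exact: ball_segment.
have [|t t01 E1] := @mean_value _ _ (fun y => Phi (y, v)) x h.
  by move=> t t01; exact: (diff_slice1 (dl t t01)).1.
by exists t => //; rewrite E1 (diff_slice1 (dl t t01)).2.
Qed.

Lemma partial1_lipschitz x : U x -> {for ((x, 0), 0), continuous (partial1 Phi)} ->
  exists C r : R, [/\ 0 <= C, 0 < r & forall y z v, ball x r y -> ball x r z ->
    `|Phi (y, v) - Phi (z, v)| <= C * `|y - z| * `|v|].
Proof.
move=> Ux cP; have [C [r [C0 r0 rU Cb]]] := partial1_bound Ux cP.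
exists C, r; split=> // y z v xy xz.
have yE : y = z + (y - z) by rewrite addrC subrK.
have xy' : ball x r (z + (y - z)) by rewrite -yE.
have [t t01 E1] := partial1_mean v rU xz xy'.
by rewrite {1}yE E1; apply: Cb; exact: ball_segment.
Qed.

End Bound.

Lemma partial1_smooth E V (U : set E) (Phi : E * V -> R) : open U ->
  smooth_on (U `*` setT) Phi -> smooth_on ((U `*` setT) `*` setT) (partial1 Phi).
Proof.
move=> oU sP n.
pose L (q : (E * E) * V) : (E * V) * (E * V) := ((q.1.1, q.2), (q.1.2, 0)).
have linL : linear L.
  move=> a [[x1 x2] x3] [[y1 y2] y3]; rewrite /L /=.
  by congr ((_, _), (_, _)); rewrite /= scaler0 addr0.
pose Lm := GRing.isLinear.Build _ _ _ _ _ linL.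
pose LL : {linear ((E * E) * V)%type -> ((E * V) * (E * V))%type} := HB.pack L Lm.
have [_ CT] := sP n.+1.
have oUT : open (U `*` [set: V]) by exact: openX openT.
apply: (@Cn_comp_linear _ n _ _ _ _ ((U `*` setT) `*` setT) LL _ _ _ _ _ CT).
- by apply: openX openT; exact: openX openT.
- exact: openX openT.
- move=> [[x h] v]; apply: pair_continuous; apply: pair_continuous.
  + by apply: (@continuous_comp _ _ _ fst fst); [exact: cvg_fst|exact: cvg_fst].
  + exact: cvg_snd.
  + by apply: (@continuous_comp _ _ _ fst snd); [exact: cvg_fst|exact: cvg_snd].
  + exact: cvg_cst.
- by move=> [[x h] v] [[/= Ux _] _].
Qed.

Lemma transposeE E V (U : set E) (Phi : E * V -> R) x : linear2_on U Phi ->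
  smooth_on (U `*` setT) Phi -> U x -> forall v, transpose Phi x v = Phi (x, v).
Proof.
move=> lP sP Ux v; rewrite /transpose to_dualE//; first by move=> a u w; exact: lP.
move=> w; apply: (@continuous_comp _ _ _ (fun v => (x, v)) Phi).
  by apply: pair_continuous; [exact: cvg_cst|exact: cvg_id].
exact: (sP 0%N).
Qed.

Section TransposeDiff.
Context (E V : normedModType R) (U : set E) (Phi : E * V -> R).
Context (oU : open U).
Context (lP : linear2_on U Phi).
Context (sP : smooth_on (U `*` setT) Phi).

Let Psi := partial1 Phi.
Let oUT : open (U `*` [set: E]).
Proof. exact: openX openT. Qed.
Let dP q : (U `*` [set: V]) q -> differentiable Phi q.
Proof. by have [+ _] := sP 1%N; exact. Qed.
Let lPsi : linear2_on (U `*` setT) Psi.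
Proof. exact: partial1_linear2. Qed.
Let sPsi : smooth_on ((U `*` setT) `*` setT) Psi.
Proof. exact: partial1_smooth. Qed.

Lemma transpose_partial1E x h v : U x ->
  transpose Psi (x, h) v = partial1 Phi ((x, h), v).
Proof. by move=> Ux; rewrite (transposeE lPsi sPsi). Qed.

(** The remainder is estimated by applying the mean value theorem to [Phi], and
    then again to its partial derivative: the second derivative is bounded near
    [x], uniformly on bounded sets of directions. *)
Lemma transpose_diff x : U x ->
  differentiable (transpose Phi) x /\
  forall h, 'd (transpose Phi) x h = transpose Psi (x, h).
Proof.
move=> Ux; have linL : linear (fun h => transpose Psi (x, h)).
  move=> a h k; apply/val_inj/funext => v.
  rewrite -[RHS]/(a * transpose Psi (x, h) v + transpose Psi (x, k) v) /=.
  by rewrite !transpose_partial1E// partial1_linear1.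
pose Lm := GRing.isLinear.Build _ _ _ _ _ linL.
pose L : {linear E -> dual_space V} := HB.pack (fun h => transpose Psi (x, h)) Lm.
have cPsi : {for ((x, 0), 0), continuous Psi} by apply: (sPsi 0%N).
have cL : continuous L.
  have [C [r [C0 r0 _ Cb]]] := partial1_bound oU lP dP Ux cPsi.
  apply/linear_bounded_continuous/linear_boundedP; exists C; split=> [|K CK h].
    exact: num_real.
  have K0 : 0 <= K by rewrite (le_trans C0)// ltW.
  apply: dual_norm_le => [|v]; first by rewrite mulr_ge0.
  rewrite /= transpose_partial1E//.
  have xx : ball x r x by exact: ballxx.
  by rewrite (le_trans (Cb x h v xx))// ler_wpM2r// ler_wpM2r// ltW.
have dPsi q : ((U `*` [set: E]) `*` [set: V]) q -> differentiable Psi q.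
  by have [+ _] := sPsi 1%N; exact.
have cPsi2 : {for (((x, 0), 0), 0), continuous (partial1 Psi)}.
  by apply: (partial1_smooth oUT sPsi 0%N).
have UTx : (U `*` [set: E]) (x, 0) by [].
have [C [r [C0 r0 Cb]]] := partial1_lipschitz oUT lPsi dPsi UTx cPsi2.
have nU : nbhs x U by exact: open_nbhs_nbhs.
have /nbhs_ballP[r' /= r'0 rU] := nU.
have [|dT dE] := @differentiable_of_remainder _ _ _ (transpose Phi) L x cL; last first.
  by split=> // h; rewrite dE.
move=> e e0; near=> h.
apply: dual_norm_le => [|v]; first by rewrite mulr_ge0// ltW.
have hr : `|h| < Num.min r r'.
  near: h; have := @nbhs0_lt R E (Num.min r r'); apply; by rewrite lt_min r0.
have [hr1 hr2] : `|h| < r /\ `|h| < r' by apply/andP; rewrite -lt_min.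
have xh' : ball x r' (x + h) by apply/ball_normP; rewrite addrC addKr.
have xh : ball x r (x + h) by apply/ball_normP; rewrite addrC addKr.
have Uxh : U (x + h) by exact: rU.
have [t t01 E1] := partial1_mean dP v rU (ballxx x r'0) xh'.
have -> : (transpose Phi (h + x) - transpose Phi x - L h) v =
    Psi ((x + t *: h, h), v) - Psi ((x, h), v).
  rewrite -[LHS]/(transpose Phi (h + x) v - transpose Phi x v - transpose Psi (x, h) v).
  rewrite addrC (addrC h) (transposeE lP sP)// (transposeE lP sP)//.
  by rewrite transpose_partial1E// E1 addrC.
have [a [k [hk kr a0 ar]]] := rescale h r0.
have xth : ball x r (x + t *: h) by apply: ball_segment => //; exact: ballxx.
rewrite {2 3}hk /Psi !partial1_scale1 -mulrBr normrM (ger0_norm a0).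
have := Cb (x + t *: h, k) (x, k) v.
have bk : ball 0 r k by apply/ball_normP; rewrite subr0.
have -> : ((x + t *: h, k) - (x, k) : E * E) = (t *: h, 0).
  by congr pair; rewrite /= ?subrr// addrC addKr.
move=> /(_ (conj xth bk) (conj (ballxx x r0) bk)) Cbv.
have nt : `|(t *: h, 0 : E)| <= `|h|.
  rewrite prod_normE /= normr0 normrZ ge_max normr_ge0 andbT.
  by case/andP: t01 => t0 t1; rewrite ger0_norm// ler_piMl.
rewrite (le_trans (ler_wpM2l a0 Cbv))//.
have he : C * (2 / r) * `|h| <= e.
  near: h; have [->|Cn0] := eqVneq C 0.
    by near=> h; rewrite !mul0r ltW.
  have Cr : 0 < C * (2 / r) by rewrite mulr_gt0// ?divr_gt0// lt_def Cn0.
  near=> h; rewrite mulrC -ler_pdivlMr// ltW//.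
  by near: h; apply: nbhs0_lt; rewrite divr_gt0.
have v0 := normr_ge0 v; have h0 := normr_ge0 h.
apply: (@le_trans _ _ ((C * (2 / r) * `|h|) * `|h| * `|v|)); last first.
  by rewrite ler_wpM2r// ler_wpM2r.
rewrite mulrA ler_wpM2r//.
have -> : C * (2 / r) * `|h| * `|h| = (2 / r * `|h|) * (C * `|h|) by ring.
apply: ler_pM => //; first by rewrite mulr_ge0.
by rewrite ler_wpM2l.
Unshelve. all: by end_near. Qed.

End TransposeDiff.

(** Continuity of the iterated tangent maps of [Phi], jointly in the base point
    and in [v], thus implies smoothness for the dual norm. *)
Lemma transpose_smooth E V (U : set E) (Phi : E * V -> R) : open U ->
  linear2_on U Phi -> smooth_on (U `*` setT) Phi -> smooth_on U (transpose Phi).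
Proof.
move=> + + + n; elim: n E V U Phi => [|n IH] E V U Phi oU lP sP.
  by move=> x Ux; apply: differentiable_continuous; exact: (transpose_diff oU lP sP Ux).1.
split=> [x Ux|]; first exact: (transpose_diff oU lP sP Ux).1.
have oUT : open (U `*` [set: E]) by exact: openX openT.
have dP q : (U `*` [set: V]) q -> differentiable Phi q.
  by have [+ _] := sP 1%N; exact.
have := IH _ _ _ _ oUT (partial1_linear2 oU lP dP) (partial1_smooth oU sP).
apply: Cn_eq => // -[x h] [/= Ux _].
by rewrite (transpose_diff oU lP sP Ux).2.
Qed.

End Transpose.

(** * Symmetry of the second derivative *)

Section Schwarz.
Context {R : realType} (E : normedModType R) (U : set E) (f : E -> R).
Context (oU : open U).
Context (sf : Cn 2 U f).

Let df x : U x -> differentiable f x.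
Proof. by have [+ _] := sf; exact. Qed.

Let dTf x u : U x -> differentiable (fun p : E * E => 'd f (p.1) p.2) (x, u).
Proof. by move=> Ux; have [_ [+ _]] := sf; apply; split. Qed.

Lemma diff_along_differentiable x u : U x ->
  differentiable (fun y => 'd f y u) x.
Proof. by move=> Ux; exact: (diff_slice1 (dTf u Ux)).1. Qed.

Lemma second_diff_continuous x u v : U x ->
  {for x, continuous (fun y => 'd (fun z => 'd f z u) y v)}.
Proof.
move=> Ux; have [_ [_ cT]] := sf.
have c2 : {for x, continuous (fun y => 'd (fun p : E * E => 'd f (p.1) p.2) (y, u) (v, 0))}.
  apply: (@continuous_comp _ _ _ (fun y => ((y, u), (v, 0)))
    (fun q => 'd (fun p : E * E => 'd f (p.1) p.2) (q.1) q.2)); last exact: cT.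
  apply: pair_continuous; last exact: cvg_cst.
  by apply: pair_continuous; [exact: cvg_id|exact: cvg_cst].
rewrite /prop_for /continuous_at (diff_slice1 (dTf u Ux)).2.
apply: cvg_trans c2; apply: near_eq_cvg.
have : nbhs x U by exact: open_nbhs_nbhs.
by apply: filterS => y Uy; rewrite (diff_slice1 (dTf u Uy)).2.
Qed.

(** The mean value theorem, once in each direction. *)
Lemma second_difference x u v (r : R) : (forall y, ball x r y -> U y) ->
  `|u| + `|v| < r -> exists2 p, `|p - x| <= `|u| + `|v| &
    f (x + u + v) - f (x + u) - (f (x + v) - f x) = 'd (fun y => 'd f y u) p v.
Proof.
move=> rU uvr.
have step (s t : R) : 0 <= s <= 1 -> 0 <= t <= 1 ->
    `|x + s *: u + t *: v - x| <= `|u| + `|v|.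
  move=> /andP[s0 s1] /andP[t0 t1].
  rewrite -(addrA x) (addrC _ (- x)) addKr (le_trans (ler_normD _ _))// !normrZ !ger0_norm//.
  by apply: lerD; rewrite ler_piMl.
have Ust (s t : R) : 0 <= s <= 1 -> 0 <= t <= 1 -> U (x + s *: u + t *: v).
  by move=> s01 t01; apply: rU; apply/ball_normP; exact: le_lt_trans (step s t s01 t01) _.
have t0 : 0 <= (0 : R) <= 1 by rewrite lexx ler01.
have t1 : 0 <= (1 : R) <= 1 by rewrite lexx ler01.
have Us (s : R) : 0 <= s <= 1 -> U (x + s *: u).
  by move=> s01; have := Ust s 0 s01 t0; rewrite scale0r addr0.
have Usv (s : R) : 0 <= s <= 1 -> U (x + s *: u + v).
  by move=> s01; have := Ust s 1 s01 t1; rewrite scale1r.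
have dshift z : U (z + v) -> differentiable (fun y => f (y + v)) z /\
    'd (fun y => f (y + v)) z u = 'd f (z + v) u.
  move=> Uz; have dz : is_diff z (fun y : E => y + v) (id + 0) by exact: is_diffD.
  have dz' : differentiable (fun y : E => y + v) z by exact: ex_diff.
  split; first exact: differentiable_comp dz' (df Uz).
  rewrite (diff_comp dz' (df Uz)) /= diff_val /=; congr ('d _ _ _).
  exact: addr0.
pose phi := (fun y => f (y + v)) - f.
have [s s01|s s01 E1] := @mean_value _ _ phi x u.
  apply: differentiableB; first exact: (dshift _ (Usv s s01)).1.
  exact/df/Us.
have [t t01|t t01 E2] := @mean_value _ _ (fun y => 'd f y u) (x + s *: u) v.
  by apply: diff_along_differentiable; exact: Ust.
exists (x + s *: u + t *: v); first exact: step.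
rewrite -E2 -(dshift _ (Usv s s01)).2 -[LHS]/(phi (x + u) - phi x) E1.
have d1 := (dshift _ (Usv s s01)).1; have d2 := df (Us s s01).
exact: (congr1 (@^~ u) (diffB d1 d2)).
Qed.

(** Exchanging [u] and [v] does not change the second difference of [f]. With [u]
    and [v] replaced by [t *: u] and [t *: v] and [t] small, it is [t * t] times
    either mixed derivative at a point close to [x]. *)
Lemma second_diff_symmetric x u v : U x ->
  'd (fun y => 'd f y u) x v = 'd (fun y => 'd f y v) x u.
Proof.
move=> Ux; set a := LHS; set b := RHS.
apply/eqP; rewrite -subr_eq0 -normr_le0; apply/ler_addgt0Pr => e e0.
rewrite add0r.
have e2 : 0 < e / 2 by rewrite divr_gt0.
have nU : nbhs x U by exact: open_nbhs_nbhs.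
have ca := @second_diff_continuous x u v Ux.
have cb := @second_diff_continuous x v u Ux.
have /nbhs_ballP[r /= r0 rP] : \forall y \near x, U y /\
    `|a - 'd (fun z => 'd f z u) y v| < e / 2 /\
    `|b - 'd (fun z => 'd f z v) y u| < e / 2.
  near=> y; split; first by near: y; exact: nU.
  by split; near: y; [exact: (@cvgr_dist_lt _ _ _ _ _ _ _ ca _ e2)|
    exact: (@cvgr_dist_lt _ _ _ _ _ _ _ cb _ e2)].
(* the summand 1 keeps [m] positive when [u] and [v] vanish *)
pose m := `|u| + `|v| + 1.
have m0 : 0 < m by rewrite ltr_wpDl// addr_ge0.
pose t := r / m.
have t0 : 0 < t by rewrite divr_gt0.
have small w : `|t *: w| = t * `|w| by rewrite normrZ gtr0_norm.
have uvr : `|t *: u| + `|t *: v| < r.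
  rewrite !small -mulrDr /t mulrAC ltr_pdivrMr// ltr_pM2l// /m ltrDl.
  exact: ltr01.
have vur : `|t *: v| + `|t *: u| < r by rewrite addrC.
have rU y : ball x r y -> U y by move=> /rP[].
have scale p w z : U p ->
    'd (fun y => 'd f y (t *: w)) p (t *: z) = t * t * 'd (fun y => 'd f y w) p z.
  move=> Up; have dw := diff_along_differentiable w Up.
  have -> : (fun y => 'd f y (t *: w)) = t *: (fun y => 'd f y w).
    by apply/funext => y; rewrite linearZ.
  rewrite linearZ /= -[t * _]/(t *: _) (diffZ _ dw) /=.
  by rewrite scalerA.
have [p px E1] := second_difference rU uvr.
have [q qx E2] := second_difference rU vur.
have bp : ball x r p by apply/ball_normP; exact: le_lt_trans px uvr.
have bq : ball x r q by apply/ball_normP; exact: le_lt_trans qx vur.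
have [Up [pa _]] := rP p bp; have [Uq [_ qb]] := rP q bq.
have pq : 'd (fun y => 'd f y u) p v = 'd (fun y => 'd f y v) q u.
  have tt : t * t != 0 by rewrite mulf_neq0// gt_eqF.
  apply: (mulfI tt); rewrite -!scale// -E1 -E2 (addrAC x) !opprB.
  by rewrite !addrA; ring.
move: pa qb => /=; rewrite pq => pa qb.
rewrite -(subrK ('d (fun y => 'd f y v) q u) a) -addrA (le_trans (ler_normD _ _))//.
by rewrite distrC in qb; rewrite (splitr e) lerD// ltW.
Unshelve. all: by end_near. Qed.

End Schwarz.

(** * Smooth maps between manifolds *)

Section SmoothNear.
Context {R : realType}.
Implicit Types E F V W : normedModType R.

Lemma Cn_cst n E F (U : set E) (a : F) : open U -> Cn n U (fun _ => a).
Proof.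
elim: n E F U a => [|n IH] E F U a oU /=; first by move=> x _; exact: cvg_cst.
split; first by move=> x _; exact: differentiable_cst.
have oUT : open (U `*` [set: E]) by exact: openX openT.
by apply: Cn_eq (IH _ _ _ 0 oUT) => // -[x v] _ /=; rewrite diff_cst.
Qed.

Definition smooth_near E F (f : E -> F) (x : E) : Prop :=
  exists U : set E, [/\ open U, U x & smooth_on U f].

Lemma smooth_near_eq E F (f g : E -> F) (x : E) :
  (\forall y \near x, f y = g y) -> smooth_near f x -> smooth_near g x.
Proof.
move=> fg [U [oU Ux sU]].
have : nbhs x (U `&` [set y | f y = g y]).
  by apply: filterI => //; exact: open_nbhs_nbhs.
rewrite nbhsE => -[B [oB Bx] BU]; exists B; split=> // n.
apply: Cn_eq (Cn_sub _ (sU n)) => //; first by move=> y /BU[].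
by move=> y /BU[].
Qed.

Lemma smooth_near_comp E F V (f : E -> F) (g : F -> V) (x : E) :
  smooth_near f x -> smooth_near g (f x) -> smooth_near (g \o f) x.
Proof.
move=> [U [oU Ux sU]] [W [oW Wx sW]].
have : nbhs x (U `&` f @^-1` W).
  apply: filterI; first exact: open_nbhs_nbhs.
  by apply: (sU 0%N x Ux); exact: open_nbhs_nbhs.
rewrite nbhsE => -[B [oB Bx] BU]; exists B; split=> // n.
apply: (Cn_comp oB oW) (sW n); first by move=> y /BU[].
by apply: Cn_sub (sU n) => y /BU[].
Qed.

Lemma smooth_near_pair E F V (f : E -> F) (g : E -> V) (x : E) :
  smooth_near f x -> smooth_near g x -> smooth_near (fun y => (f y, g y)) x.
Proof.
move=> [U [oU Ux sU]] [W [oW Wx sW]]; exists (U `&` W).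
have oUW : open (U `&` W) by exact: openI.
split=> // n; apply: Cn_pair => //.
  by apply: Cn_sub (sU n) => y [].
by apply: Cn_sub (sW n) => y [].
Qed.

Lemma smooth_near_linear E F (f : {linear E -> F}) (x : E) :
  continuous f -> smooth_near f x.
Proof.
move=> cf; exists setT; split=> //; first exact: openT.
by move=> n; apply: Cn_linear => //; exact: openT.
Qed.

Lemma smooth_near_cst E F (a : F) (x : E) : smooth_near (fun _ => a) x.
Proof.
by exists setT; split=> [||n] //; [exact: openT|apply: Cn_cst; exact: openT].
Qed.

Lemma smooth_near_differentiable E F (f : E -> F) (x : E) :
  smooth_near f x -> differentiable f x.
Proof. by move=> [U [_ Ux /(_ 1%N)[df _]]]; exact: df. Qed.

Lemma smooth_near_continuous E F (f : E -> F) (x : E) :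
  smooth_near f x -> {for x, continuous f}.
Proof. by move=> /smooth_near_differentiable/differentiable_continuous. Qed.

Lemma smooth_near_tangent E F (f : E -> F) (x v : E) :
  smooth_near f x -> smooth_near (fun p : E * E => 'd f (p.1) p.2) (x, v).
Proof.
move=> [U [oU Ux sU]]; exists (U `*` setT); split=> //.
  exact: openX openT.
by move=> n; have [] := sU n.+1.
Qed.

End SmoothNear.

Section SmoothMaps.
Context {R : realType}.
Implicit Types E F V W : normedModType R.

Lemma local_repE E F (M : manifold E) (N : manifold F) (f : M -> N) (p : M) :
  local_rep f p (chart_at p p) = chart_at (f p) (f p).
Proof. by rewrite /local_rep /= chart_atK//; exact: chart_at_dom. Qed.

Lemma smooth_at_comp E F V (M : manifold E) (N : manifold F) (P : manifold V)
    (f : M -> N) (g : N -> P) (p : M) :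
  smooth_at f p -> smooth_at g (f p) -> smooth_at (g \o f) p.
Proof.
move=> [cf sf] [cg sg]; split; first exact: continuous_comp.
rewrite -local_repE in sg; apply: smooth_near_eq (smooth_near_comp sf sg).
have nd : \forall q \near p, chart_dom (chart_at (f p)) (f q).
  by apply: cf; exact: near_chart_dom.
by apply: filterS (near_chart_inv nd) => x dx; rewrite /local_rep /= chart_atK.
Qed.

Lemma smooth_at_cst E F (M : manifold E) (N : manifold F) (a : N) (p : M) :
  smooth_at (fun _ : M => a) p.
Proof. by split; [exact: cvg_cst|exact: smooth_near_cst]. Qed.

Lemma smooth_at_pair E F V (M : manifold E) (N : manifold F) (P : manifold V)
    (f : M -> N) (g : M -> P) (p : M) : smooth_at f p -> smooth_at g p ->
  smooth_at (N := prod_mfd N P) (fun q => (f q, g q)) p.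
Proof.
move=> [cf sf] [cg sg]; split; first exact: pair_continuous.
exact: (smooth_near_pair sf sg).
Qed.

Lemma smooth_at_fst E F (M : manifold E) (N : manifold F) (p : prod_mfd M N) :
  smooth_at (M := prod_mfd M N) (N := M) fst p.
Proof.
split; first exact: cvg_fst.
apply: (@smooth_near_eq _ _ _ (fst : {linear (E * F)%type -> E})); last first.
  by apply: smooth_near_linear => x; exact: cvg_fst.
apply: filterS (@near_chart_cod _ _ (prod_mfd M N) p) => _ [q [/= dq _] <-].
by rewrite /local_rep /= chart_atK.
Qed.

Lemma smooth_at_snd E F (M : manifold E) (N : manifold F) (p : prod_mfd M N) :
  smooth_at (M := prod_mfd M N) (N := N) snd p.
Proof.
split; first exact: cvg_snd.
apply: (@smooth_near_eq _ _ _ (snd : {linear (E * F)%type -> F})); last first.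
  by apply: smooth_near_linear => x; exact: cvg_snd.
apply: filterS (@near_chart_cod _ _ (prod_mfd M N) p) => _ [q [/= _ dq] <-].
by rewrite /local_rep /= chart_atK.
Qed.

Lemma smooth_at_vec E F (M : manifold E) (f : M -> vec_mfd F) (p : M) :
  smooth_near (f \o chart_inv (chart_at p)) (chart_at p p) -> smooth_at f p.
Proof.
move=> sf; split=> //.
have [cM dM _] := manifold_atlas M; have [_ _ _ cc _] := cM p.
have : {for p, continuous ((f \o chart_inv (chart_at p)) \o chart_at p)}.
  apply: continuous_comp; first exact: cc.
  exact: smooth_near_continuous.
rewrite /prop_for /continuous_at /= chart_atK; last exact: dM.
apply: cvg_trans; apply: near_eq_cvg.
by apply: filterS (@near_chart_dom _ E M p) => q dq /=; rewrite chart_atK.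
Qed.

Lemma smooth_at_pair_vec E F V (M : manifold E) (f : M -> vec_mfd F)
    (g : M -> vec_mfd V) (p : M) : smooth_at f p -> smooth_at g p ->
  smooth_at (N := vec_mfd (F * V)%type) (fun q => (f q, g q)) p.
Proof. by move=> [cf sf] [cg sg]; apply: smooth_at_vec; exact: smooth_near_pair. Qed.

Lemma smooth_at_linear E F (f : {linear E -> F}) (x : E) : continuous f ->
  smooth_at (M := vec_mfd E) (N := vec_mfd F) f x.
Proof. by move=> cf; apply: smooth_at_vec; exact: smooth_near_linear. Qed.

Lemma smooth_at_add E F (M : manifold E) (f g : M -> vec_mfd F) (p : M) :
  smooth_at f p -> smooth_at g p ->
  smooth_at (N := vec_mfd F) (fun q => f q + g q : F) p.
Proof.
move=> sf sg; have linA : linear (fun x : F * F => x.1 + x.2).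
  by move=> a [x1 x2] [y1 y2] /=; rewrite scalerDr addrACA.
pose Am := GRing.isLinear.Build _ _ _ _ _ linA.
pose A : {linear (F * F)%type -> F} := HB.pack (fun x : F * F => x.1 + x.2) Am.
apply: (smooth_at_comp (smooth_at_pair_vec sf sg)
  (g := (A : vec_mfd (F * F)%type -> vec_mfd F))).
apply: smooth_at_linear => x.
by apply: (@continuousD _ _ _ fst snd); [exact: cvg_fst|exact: cvg_snd].
Qed.

Lemma smooth_at_opp E F (M : manifold E) (f : M -> vec_mfd F) (p : M) :
  smooth_at f p -> smooth_at (N := vec_mfd F) (fun q => - (f q : F)) p.
Proof.
move=> sf; apply: (smooth_at_comp sf (g := (-%R : vec_mfd F -> vec_mfd F))).
by apply: (@smooth_at_linear _ _ (@GRing.opp F)) => x; exact: opp_continuous.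
Qed.

Lemma open_transition_dom E (M : manifold E) (p q : M) :
  open (transition_dom (chart_at p) (chart_at q)).
Proof.
have [cM _ _] := manifold_atlas M; have [_ o' _ _ i'] := cM p.
have [oq _ _ _ _] := cM q.
rewrite openE => x [cx dx].
have n1 : nbhs x (chart_cod (chart_at p)) by exact: open_nbhs_nbhs.
have n2 : nbhs x (chart_inv (chart_at p) @^-1` chart_dom (chart_at q)).
  by apply: (i' x cx); exact: open_nbhs_nbhs.
exact: filterI n1 n2.
Qed.

Lemma smooth_at_chart E (M : manifold E) (p q : M) : chart_dom (chart_at p) q ->
  smooth_at (N := vec_mfd E) (chart_at p) q.
Proof.
move=> dq; have [cM dM tM] := manifold_atlas M.
apply: smooth_at_vec; exists (transition_dom (chart_at q) (chart_at p)).
split; [exact: open_transition_dom| |exact: tM].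
by split; [exists q => //; exact: dM|rewrite /= chart_atK//; exact: dM].
Qed.

Lemma smooth_at_chart_inv E (M : manifold E) (p : M) (x : E) :
  chart_cod (chart_at p) x ->
  smooth_at (M := vec_mfd E) (chart_inv (chart_at p)) x.
Proof.
move=> cx; have [cM dM tM] := manifold_atlas M.
have [_ _ _ _ ci] := cM p; split; first exact: ci.
exists (transition_dom (chart_at p) (chart_at (chart_inv (chart_at p) x))).
by split; [exact: open_transition_dom|split=> //; exact: dM|exact: tM].
Qed.

Lemma chart_cod_at E (M : manifold E) (p : M) : chart_cod (chart_at p) (chart_at p p).
Proof. by exists p => //; exact: chart_at_dom. Qed.

Lemma chart_invK E (M : manifold E) (p : M) (x : E) : chart_cod (chart_at p) x ->
  chart_dom (chart_at p) (chart_inv (chart_at p) x) /\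
  chart_at p (chart_inv (chart_at p) x) = x.
Proof. by move=> [q dq <-]; rewrite chart_atK. Qed.

Lemma tangent_map_chart_inv E (M : manifold E) (p : M) :
  tangent_map (M := vec_mfd E) (chart_inv (chart_at p)) (chart_at p p) = id.
Proof.
have did : differentiable (@id E) (chart_at p p) by exact: ex_diff.
rewrite /tangent_map.
have [|_ ->] := @near_eq_diff _ _ _ id (local_rep (M := vec_mfd E)
  (chart_inv (chart_at p)) (chart_at p p)) (chart_at p p) _ did; last first.
  exact: diff_val.
apply: filterS (@near_chart_cod _ E M p) => x [q dq <-].
rewrite /local_rep /= (chart_atK dq) chart_atK//; exact: chart_at_dom.
Qed.

Lemma tangent_map_fst E F (M : manifold E) (N : manifold F) (p : prod_mfd M N) :
  tangent_map (M := prod_mfd M N) (N := M) fst p = fst.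
Proof.
have [d1 dE] := fst_diff (chart_at p p : E * F).
have fE : \forall x \near chart_at p p, fst x =
    local_rep (M := prod_mfd M N) (N := M) fst p x.
  apply: filterS (@near_chart_cod _ _ (prod_mfd M N) p) => _ [q [/= dq _] <-].
  by rewrite /local_rep /= chart_atK.
by rewrite /tangent_map (near_eq_diff fE d1).2 dE.
Qed.

Lemma tangent_map_snd E F (M : manifold E) (N : manifold F) (p : prod_mfd M N) :
  tangent_map (M := prod_mfd M N) (N := N) snd p = snd.
Proof.
have [d1 dE] := snd_diff (chart_at p p : E * F).
have fE : \forall x \near chart_at p p, snd x =
    local_rep (M := prod_mfd M N) (N := N) snd p x.
  apply: filterS (@near_chart_cod _ _ (prod_mfd M N) p) => _ [q [/= _ dq] <-].
  by rewrite /local_rep /= chart_atK.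
by rewrite /tangent_map (near_eq_diff fE d1).2 dE.
Qed.

End SmoothMaps.

(** * Differentials in charts, and graphs *)

Section Forms.
Context {R : realType}.
Implicit Types E F V W : normedModType R.

Lemma differential_chart_inv E (M : manifold E) (f : M -> vec_mfd R) (p : M)
    (x v : E) : chart_cod (chart_at p) x ->
  smooth_at f (chart_inv (chart_at p) x) ->
  differential f (chart_inv (chart_at p) x)
    (tangent_map (M := vec_mfd E) (chart_inv (chart_at p)) x v) =
  'd (f \o chart_inv (chart_at p)) x v.
Proof.
move=> cx sf.
have dc := smooth_differentiable_at (smooth_at_chart_inv cx).
have [_ TE] := tangent_map_comp dc (smooth_differentiable_at sf).
exact: esym (congr1 (@^~ v) TE).
Qed.

(** In charts this map is the transpose of a partial tangent map of [K]. *)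
Lemma smooth_partial_differential E F (M : manifold E) (N : manifold F)
    (K : prod_mfd M N -> vec_mfd R) (p : M) :
  smooth_map (M := prod_mfd M N) (N := vec_mfd R) K ->
  smooth_map (M := N) (N := vec_mfd (dual_space E))
    (fun n => to_dual (differential (fun m => K (m, n)) p)).
Proof.
move=> sK n; apply: smooth_at_vec.
have [_ [W [oW Wx sW]]] := sK (p, n).
set Kc : E * F -> R := local_rep _ _ in sW.
pose x0 := chart_at p p; pose U : set F := (fun y => (x0, y)) @^-1` W.
have oU : open U.
  apply: open_comp => // y _.
  apply: (@pair_continuous _ _ _ (fun=> x0) id y); last exact: cvg_id.
  exact: cvg_cst.
pose Phi (q : F * E) : R := 'd Kc (x0, q.1) (q.2, 0).
have lP : linear2_on U Phi.
  move=> y Uy a v w; rewrite /Phi /= -[a * _]/(a *: _) -linearP; congr ('d _ _ _).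
  by congr pair; rewrite /= scaler0 addr0.
have sP : smooth_on (U `*` setT) Phi.
  move=> k; have [_ CT] := sW k.+1.
  have oUT : open (U `*` [set: E]) by exact: openX openT.
  have cfst : Cn k (U `*` [set: E]) (fst : {linear (F * E)%type -> F}).
    by apply: Cn_linear => // q; exact: cvg_fst.
  have csnd : Cn k (U `*` [set: E]) (snd : {linear (F * E)%type -> E}).
    by apply: Cn_linear => // q; exact: cvg_snd.
  have Cg : Cn k (U `*` [set: E]) (fun q : F * E => ((x0, q.1), (q.2, 0 : F))).
    by apply: Cn_pair => //; apply: Cn_pair => //; exact: Cn_cst.
  apply: (Cn_comp oUT _ _ Cg CT); first exact: openX openT.
  by move=> [y v] [/= Uy _].
have sT := transpose_smooth oU lP sP.
apply: (@smooth_near_eq _ _ _ (transpose Phi)); last by exists U.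
have : nbhs (chart_at n n) U by exact: open_nbhs_nbhs.
apply: filterS => y Uy; rewrite /transpose; congr to_dual; apply/funext => v.
have dK : differentiable Kc (x0, y) by have [+ _] := sW 1%N; exact.
by rewrite /Phi /= -(diff_slice1 dK).2.
Qed.

Lemma to_dual_differential E (M : manifold E) (f : M -> vec_mfd R) (p : M) (v : E) :
  smooth_at f p -> to_dual (differential f p) v = differential f p v.
Proof.
move=> sf; have [_ df] := smooth_differentiable_at sf.
rewrite to_dualE//; last exact: diff_continuous.
by move=> a x y; rewrite /differential /tangent_map linearP.
Qed.

Lemma velocityE E (M : manifold E) (c : vec_mfd R -> M) (t : R) :
  smooth_at (M := vec_mfd R) c t -> velocity c t = tangent_map (M := vec_mfd R) c t 1.
Proof. by move=> /smooth_differentiable_at[_ dc]; rewrite /velocity deriveE. Qed.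

End Forms.

Section Graph.
Context {R : realType} (E V : normedModType R) (M : manifold E).
Context (s : M -> vec_mfd V).
Context (ss : smooth_map (N := vec_mfd V) s).

Let P := prod_mfd M (vec_mfd V).
Let S : set P := [set q | q.2 = s q.1].

(** The chart [(q, w) |-> (q, w - s q)] straightens the graph. *)
Lemma graph_submanifold : submanifold S.
Proof.
move=> p Sp.
pose U : set P := chart_dom (chart_at p.1) `*` setT.
pose W : set (E * V) := chart_cod (chart_at p.1) `*` setT.
pose f (q : P) : vec_mfd (E * V)%type := (chart_at p.1 q.1, q.2 - s q.1).
pose h (x : vec_mfd (E * V)%type) : P :=
  (chart_inv (chart_at p.1) x.1, x.2 + s (chart_inv (chart_at p.1) x.1)).
have [cM dM _] := manifold_atlas M; have [od oc _ _ _] := cM p.1.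
exists E, V, U, W, f, h; split; first by split=> //; exact: dM.
split.
- exact: openX openT.
- exact: openX openT.
- move=> q [/= dq _]; rewrite /f /h /= chart_atK// subrK; split.
  + by split=> //; exists q.1.
  + by case: q dq.
  + apply: smooth_at_pair_vec.
      apply: (smooth_at_comp (@smooth_at_fst _ _ _ M (vec_mfd V) q)
        (g := (chart_at p.1 : M -> vec_mfd E))); exact: smooth_at_chart.
    apply: smooth_at_add; first exact: (@smooth_at_snd _ _ _ M (vec_mfd V)).
    apply: smooth_at_opp.
    exact: (smooth_at_comp (@smooth_at_fst _ _ _ M (vec_mfd V) q)).
- move=> x [/= cx _]; have [dx xE] := chart_invK cx; rewrite /f /h /=; split.
  + by split.
  + by rewrite xE addrK; case: x {cx dx xE}.
  + have s1 : smooth_at (M := vec_mfd (E * V)%type) (N := vec_mfd E) fst x.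
      apply: (@smooth_at_linear _ _ _ (fst : {linear (E * V)%type -> E})) => y.
      exact: cvg_fst.
    have s2 : smooth_at (M := vec_mfd (E * V)%type) (N := vec_mfd V) snd x.
      apply: (@smooth_at_linear _ _ _ (snd : {linear (E * V)%type -> V})) => y.
      exact: cvg_snd.
    have s3 := smooth_at_comp s1 (smooth_at_chart_inv cx).
    apply: smooth_at_pair => //; apply: smooth_at_add => //.
    exact: (smooth_at_comp s3 (ss _)).
- by move=> q _ /=; rewrite /S /f /=; split=> [->|/subr0_eq//]; rewrite subrr.
Qed.

(** Velocities of curves on the graph are found by the chain rule; conversely, a
    straight line in the chart of [M], lifted to the graph, has the required
    velocity. *)
Lemma graph_tangent_space p : S p ->
  tangent_space S p = [set v | v.2 = tangent_map s p.1 v.1].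
Proof.
move=> Sp; apply/seteqP; split=> [_ [c [sc c0 cS <-]]|[z w] /= wE].
  rewrite /= (velocityE sc).
  have dc := smooth_differentiable_at sc.
  have df := smooth_differentiable_at (@smooth_at_fst _ _ _ M (vec_mfd V) (c 0)).
  have ds := smooth_differentiable_at (@smooth_at_snd _ _ _ M (vec_mfd V) (c 0)).
  have [dfc fcE] := tangent_map_comp dc df.
  have [dsc scE] := tangent_map_comp dc ds.
  have [_ sfcE] := tangent_map_comp dfc (smooth_differentiable_at (ss _)).
  have ceq : \forall t \near (0 : vec_mfd R), (snd \o c) t = (s \o (fst \o c)) t.
    by apply: filterS cS.
  have [_ TE] := tangent_map_near ceq dsc.
  have := congr1 (@^~ (1 : R)) scE; rewrite (tangent_map_snd (c 0)) /= => <-.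
  rewrite -TE sfcE /= fcE /= (tangent_map_fst (c 0)) c0 //.
pose x0 := chart_at p.1 p.1.
pose l (t : vec_mfd R) : vec_mfd E := x0 + (t : R) *: z.
pose b : vec_mfd R -> M := chart_inv (chart_at p.1) \o l.
pose c (t : vec_mfd R) : P := (b t, s (b t)).
have sl : smooth_at (M := vec_mfd R) (N := vec_mfd E) l (0 : R).
  apply: smooth_at_add; first exact: smooth_at_cst.
  pose L : {linear R -> E} := HB.pack (fun t : R => t *: z) (GRing.isLinear.Build _ _ _ _
    (fun t : R => t *: z) (fun a x y => etrans (scalerDl z (a * x) y)
       (congr1 (fun e => e + y *: z) (esym (scalerA a x z))))).
  apply: (@smooth_at_linear _ _ _ L) => t; apply: cvgZr_tmp; exact: cvg_id.
have l0 : l (0 : R) = x0 by rewrite /l scale0r addr0.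
have cx0 : chart_cod (chart_at p.1) (l (0 : R)) by rewrite l0; exact: chart_cod_at.
have sci := smooth_at_chart_inv cx0.
have sb : smooth_at (M := vec_mfd R) b (0 : R) := smooth_at_comp sl sci.
have b0 : b (0 : R) = p.1 by rewrite /b /= l0 chart_atK//; exact: chart_at_dom.
have sc : smooth_at (M := vec_mfd R) c (0 : R).
  by apply: smooth_at_pair => //; exact: (smooth_at_comp sb (ss _)).
have Tl : tangent_map (M := vec_mfd R) (N := vec_mfd E) l (0 : R) 1 = z.
  by have [_ lE] := line_diff x0 z 0; rewrite -[LHS]/('d l 0 1) lE scale1r.
have Tb : tangent_map (M := vec_mfd R) b (0 : R) 1 = z.
  have [_ ->] := tangent_map_comp (smooth_differentiable_at sl) (smooth_differentiable_at sci).
  by rewrite /= Tl l0 (tangent_map_chart_inv p.1).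
exists c; split=> //.
- rewrite /c b0; case: p Sp {x0 l b c sl l0 cx0 sci sb b0 sc Tl Tb wE} => q v /=.
  by rewrite /S /= => ->.
- by near=> t.
rewrite velocityE//.
have dc := smooth_differentiable_at sc.
have df := smooth_differentiable_at (@smooth_at_fst _ _ _ M (vec_mfd V) (c (0 : R))).
have ds := smooth_differentiable_at (@smooth_at_snd _ _ _ M (vec_mfd V) (c (0 : R))).
have [_ fcE] := tangent_map_comp dc df.
have [_ scE] := tangent_map_comp dc ds.
have [_ sbE] := tangent_map_comp (smooth_differentiable_at sb)
  (smooth_differentiable_at (ss (b (0 : R)))).
have := congr1 (@^~ (1 : R)) scE; rewrite (tangent_map_snd (c (0 : R))) /= => T2.
have := congr1 (@^~ (1 : R)) fcE; rewrite (tangent_map_fst (c (0 : R))) /= => T1.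
rewrite [LHS]surjective_pairing -T1 -T2; congr pair; first exact: Tb.
have -> : snd \o c = s \o b by [].
by rewrite sbE /= Tb b0 wE.
Unshelve. all: by end_near. Qed.

End Graph.

(** * Lagrangian graphs *)

Section GraphLagrangian.
Context {R : realType} (E V : normedModType R) (M : manifold E).
Context (s : M -> vec_mfd V) (H : M -> vec_mfd R).
Context (ss : smooth_map (N := vec_mfd V) s).
Context (sH : smooth_map (N := vec_mfd R) H).

Let P := prod_mfd M (vec_mfd V).
Let S : set P := [set q | q.2 = s q.1].
Let pr : P -> M := fst.

Context (th : P -> E * V -> R) (B : P -> V -> E -> R).
Context (th_graph : forall q, S q -> forall w,
  th q w = - pullback pr (differential H) q w).
Context (th_diff : forall p, S p -> forall v,
  differentiable (fun y => form_rep th p y v) (chart_at p p)).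
Context (th_vertical : forall p, S p -> forall w v,
  'd (fun y => form_rep th p y v) (chart_at p p) (0, w) = B p w v.1).
Context (B_nondeg : forall p, S p -> forall w,
  (forall z, B p w z = 0) -> w = 0).

(** Along the graph [th] is minus the pull-back of [dH], so its derivative in a
    direction tangent to the graph is minus the Hessian of [H]. *)
Lemma form_rep_along_graph p z v : S p ->
  'd (fun y => form_rep th p y v) (chart_at p p) (z, tangent_map s p.1 z) =
  - 'd (fun x => 'd (H \o chart_inv (chart_at p.1)) x v.1) (chart_at p.1 p.1) z.
Proof.
move=> Sp; set x0 := chart_at p.1 p.1; set Hc := H \o _.
pose sc : E -> V := s \o chart_inv (chart_at p.1).
have x0E : chart_inv (chart_at p.1) x0 = p.1.
  by rewrite /x0 chart_atK//; exact: chart_at_dom.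
have sc0 : (x0, sc x0) = chart_at p p.
  by rewrite /sc /= x0E -Sp.
have dsc : differentiable sc x0 := (smooth_differentiable_at (ss p.1)).2.
have sHc : smooth_near Hc x0 := (sH p.1).2.
have dg : differentiable (fun x => (x, sc x)) x0 by exact: differentiable_pair.
have dth : differentiable (fun y => form_rep th p y v) (x0, sc x0).
  by rewrite sc0; exact: th_diff.
have E1 : \forall x \near x0,
    - 'd Hc x v.1 = form_rep th p (x, sc x) v.
  apply: filterS (@near_chart_cod _ _ M p.1) => x cx.
  have [dx xE] := chart_invK cx.
  pose q : P := chart_inv (chart_at p) (x, sc x).
  have Sq : S q by [].
  have cy : chart_cod (chart_at p) (x, sc x).
    by exists q; [split|congr pair].
  have sf := @smooth_at_fst _ _ _ M (vec_mfd V) q.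
  have sHf : smooth_at (M := P) (N := vec_mfd R) (H \o pr) q.
    exact: smooth_at_comp sf (sH _).
  rewrite /form_rep -/q th_graph// /pullback; congr (- _).
  have [_ TE] := tangent_map_comp (smooth_differentiable_at sf)
    (smooth_differentiable_at (sH q.1)).
  have := differential_chart_inv v cy sHf; rewrite /differential TE /= => ->.
  have dHx : differentiable Hc x.
    exact: (smooth_near_differentiable (smooth_at_comp (smooth_at_chart_inv cx) (sH _)).2).
  have [df fE] := fst_diff (x, sc x).
  by rewrite -[RHS]/('d (Hc \o fst) (x, sc x) v) (diff_comp df dHx) /= fE.
have dHv : differentiable (fun x => 'd Hc x v.1) x0.
  have [U [oU Ux sU]] := sHc; exact: (diff_along_differentiable (sU 2%N) v.1 Ux).
have [_ D1] := near_eq_diff E1 (differentiableN dHv).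
have := diff_comp dg dth => /(congr1 (@^~ z)) /=.
rewrite sc0 diff_pair//= => D2.
have iE : 'd (@id E) x0 z = z by rewrite diff_val.
rewrite iE in D2.
rewrite -[LHS]D2 -/sc -[LHS]/('d (fun x => form_rep th p (x, sc x) v) x0 z) D1.
exact: (congr1 (@^~ z) (diffN dHv)).
Qed.

(** In the decomposition of [u] into a vector tangent to the graph and a vertical
    one, the first part contributes a Hessian of [H], which cancels by symmetry
    against the other term of the exterior derivative. *)
Lemma exterior_derivative_graph p u z : S p ->
  exterior_derivative th p u (z, tangent_map s p.1 z) =
  B p (u.2 - tangent_map s p.1 u.1) z.
Proof.
move=> Sp; have [U [oU Ux sU]] := (sH p.1).2.
have sym := second_diff_symmetric oU (sU 2%N) z u.1 Ux.
have uE : u = (u.1, tangent_map s p.1 u.1) + (0, u.2 - tangent_map s p.1 u.1).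
  case: u {sym} => u1 u2; congr pair; rewrite /= ?addr0//.
  by rewrite addrC subrK.
rewrite /exterior_derivative form_rep_along_graph//.
rewrite {1}uE linearD /= form_rep_along_graph// th_vertical//=.
rewrite -[H \o _]/(local_rep (N := vec_mfd R) H p.1).
have -> := sym.
by rewrite addrAC subrr add0r.
Qed.

(** By [exterior_derivative_graph] the two-form pairs a vector [u] with the
    tangent vectors of the graph through the vertical defect of [u] only. The
    defect of a tangent vector is zero, and conversely the defect of an orthogonal
    vector is zero since [B] is nondegenerate. *)
Lemma graph_lagrangian : lagrangian_submanifold (exterior_derivative th) S.
Proof.
split; first exact: graph_submanifold.
move=> p Sp; rewrite (graph_tangent_space ss Sp); apply/seteqP; split=> u /=.
  move=> uE [z w] /= ->; rewrite exterior_derivative_graph// uE subrr.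
  have := th_vertical Sp 0 (z, 0 : V); rewrite /= => <-.
  by rewrite -[X in 'd _ _ X]/(0 : E * V) linear0.
move=> uO; apply/subr0_eq/(B_nondeg Sp) => z.
by rewrite -exterior_derivative_graph//; exact: uO.
Qed.

End GraphLagrangian.

(** * The pairing of the model space with itself *)

Section Pairing.
Context {R : realType} {E : completeNormedModType R}.

(** The value of [theta1] on a vector whose base component is [z] in the right
    trivialization, see [theta1E]. *)
Definition pairing (w : E * dual_space E) (z : E * dual_space E) : R :=
  w.2 z.1 - z.2 w.1.

Lemma dual_combE (a : R) (f g : dual_space E) (x : E) :
  (a *: f + g) x = a * f x + g x.
Proof. by []. Qed.

Lemma pairing_linearl (z : E * dual_space E) : linear (pairing^~ z).
Proof.
move=> a [x1 x2] [y1 y2]; have e1 := (dualP z.2).1 a x1 y1.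
apply: (etrans (congr2 (fun u v => u - v) (dual_combE a x2 y2 z.1) e1)).
rewrite -[RHS]/(a * (x2 z.1 - z.2 x1) + (y2 z.1 - z.2 y1)); ring.
Qed.

Lemma pairing_inj (w w' : E * dual_space E) :
  (forall z, pairing w z = pairing w' z) -> w = w'.
Proof.
case: w w' => [x f] [x' f'] ww; congr pair.
  apply: dual_separates => b; have := ww (0, b).
  by rewrite /pairing /= !linear0 !sub0r => /oppr_inj.
apply/val_inj/funext => z; have := ww (z, 0).
by rewrite /pairing /= !subr0.
Qed.

Lemma evaluation_linear (x : E) : linear (fun f : dual_space E => f x).
Proof. by []. Qed.

Lemma evaluation_continuous (x : E) : continuous (fun f : dual_space E => f x).
Proof.
pose m := GRing.isLinear.Build _ _ _ _ _ (evaluation_linear x).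
pose L : {linear dual_space E -> R} := HB.pack (fun f : dual_space E => f x) m.
suff : continuous L by [].
apply/linear_bounded_continuous/linear_boundedP; exists `|x|; split=> [|K xK f].
  exact: num_real.
by rewrite (le_trans (ler_dual_norm f x))// mulrC ler_wpM2r// ltW.
Qed.

Lemma evaluation_differentiable (f : dual_space E) (x : E) :
  differentiable (fun p : dual_space E * E => p.1 p.2) (f, x).
Proof.
have lin : linear (fun p : dual_space E * E => f p.2 + p.1 x).
  move=> a [h1 k1] [h2 k2]; rewrite /= linearP /= scalerDr addrACA.
  by congr (_ + _).
pose m := GRing.isLinear.Build _ _ _ _ _ lin.
pose L : {linear (dual_space E * E)%type -> R} :=
  HB.pack (fun p : dual_space E * E => f p.2 + p.1 x) m.
have cL : continuous L.
  move=> p; apply: (@continuousD _ _ _ (f \o snd) ((fun g : dual_space E => g x) \o fst)).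
    apply: continuous_comp; first exact: cvg_snd.
    by have [_ cf] := dualP f; exact: cf.
  by apply: continuous_comp; [exact: cvg_fst|exact: evaluation_continuous].
have [|dev _] := @differentiable_of_remainder _ _ _
  (fun p : dual_space E * E => p.1 p.2) L (f, x) cL; last by [].
move=> e e0; have : \forall p \near (0 : dual_space E * E), `|p| < e.
  exact: nbhs0_lt.
apply: filterS => -[h k] /ltW hke.
have eE : (h + f) (k + x) = h k + h x + (f k + f x).
  rewrite -[LHS]/(h (k + x) + f (k + x)) !linearD //.
rewrite -[X in `|X|]/((h + f) (k + x) - f x - (f k + h x)) eE.
have -> : h k + h x + (f k + f x) - f x - (f k + h x) = h k by ring.
rewrite (le_trans (ler_dual_norm h k))//.
have hh : `|h| <= `|(h, k)| by rewrite prod_normE le_max lexx.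
have kk : `|k| <= `|(h, k)| by rewrite prod_normE le_max lexx orbT.
by apply: ler_pM => //; exact: le_trans hh hke.
Qed.

(** The inverse of [w |-> pairing w], which exists by reflexivity; its
    continuity rests on the existence of norming functionals. *)
Lemma pairing_inverse : reflexive_space E ->
  exists L : {linear dual_space (E * dual_space E)%type -> (E * dual_space E)%type},
    continuous L /\ forall phi z, pairing (L phi) z = phi z.
Proof.
move=> reflE.
have ex (phi : dual_space (E * dual_space E)%type) :
    exists w, forall z, pairing w z = phi z.
  have [_ cphi] := dualP phi.
  have l1 (a : R) u v : phi (a *: u + v, 0) = a * phi (u, 0) + phi (v, 0).
    rewrite -[a * _]/(a *: _) -linearP; congr (phi _).
    by congr pair; rewrite /= scaler0 addr0.
  have l2 (a : R) b c : - phi (0, a *: b + c) = a * - phi (0, b) + - phi (0, c).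
    rewrite mulrN -opprD -[a * _]/(a *: _) -linearP; congr (- phi _).
    by congr pair; rewrite /= scaler0 addr0.
  have c1 : continuous (fun u => phi (u, 0)).
    move=> v; apply: (@continuous_comp _ _ _ (fun u => (u, 0)) phi).
      by apply: pair_continuous; [exact: cvg_id|exact: cvg_cst].
    exact: cphi.
  have c2 : continuous (fun b => - phi (0, b)).
    move=> v; apply: (@continuousN _ _ _ (fun b => phi (0, b))).
    apply: (@continuous_comp _ _ _ (fun b => (0, b)) phi).
      apply: (@pair_continuous _ _ _ (fun=> 0 : E) id v); last exact: cvg_id.
      exact: cst_continuous.
    exact: cphi.
  have [x xE] := reflE (to_dual (fun b => - phi (0, b))).
  exists (x, to_dual (fun u => phi (u, 0))) => -[u b].
  rewrite /pairing /= -xE (to_dualE l1 c1) (to_dualE l2 c2) opprK -linearD.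
  by congr (phi _); congr pair; rewrite /= ?addr0 ?add0r.
have [L LE] := choice ex.
have linL : linear L.
  move=> a f g; apply: pairing_inj => z.
  by rewrite (pairing_linearl z a (L f) (L g)) !LE.
pose m := GRing.isLinear.Build _ _ _ _ _ linL.
pose LL : {linear dual_space (E * dual_space E)%type -> (E * dual_space E)%type} :=
  HB.pack L m.
exists LL; split=> //.
apply/linear_bounded_continuous/linear_boundedP; exists 1; split=> [|K K1 phi].
  exact: num_real.
have K0 : 1 * `|phi| <= K * `|phi| by rewrite ler_wpM2r// ltW.
rewrite (le_trans _ K0)// mul1r prod_normE ge_max; apply/andP; split.
  have [b b1 bx] := norming_functional (L phi).1.
  have := ler_dual_norm phi (0, b); rewrite -LE /pairing /= linear0 sub0r normrN.
  rewrite bx normr_id => /le_trans; apply.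
  rewrite ler_piMr// prod_normE /= normr0 ge_max ler01; exact: b1.
apply: dual_norm_le => // u.
have := ler_dual_norm phi (u, 0); rewrite -LE /pairing /= subr0 => /le_trans; apply.
by rewrite ler_wpM2l// prod_normE /= normr0 ge_max lexx normr_ge0.
Qed.

Lemma pairing_continuousl (z : E * dual_space E) : continuous (pairing^~ z).
Proof.
move=> w; apply: (@continuousB _ _ _ ((fun f : dual_space E => f z.1) \o snd) (z.2 \o fst)).
  apply: continuous_comp; first exact: cvg_snd.
  exact: evaluation_continuous.
apply: continuous_comp; first exact: cvg_fst.
by have [_ cz] := dualP z.2; exact: cz.
Qed.

End Pairing.

(** * The Hamiltonian section *)

Section LieGraph.
Context {R : realType} {E : completeNormedModType R} (G : lieGroup E).

(** The brackets cancel: [- nu2 xi] contributes [mu (bracket xi2 xi)], which is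
    [- mu (bracket xi xi2)]. *)
Lemma theta1E (p : TTstarG G) W :
  theta1 p W = pairing p.2 (right_triv p.1.1 W.1.1, W.1.2).
Proof.
case: p W => -[g mu] [xi nu] [[Wg Wmu] Wf]; pose x := right_triv g Wg.
rewrite -[LHS]/(nu x - (Wmu xi - ad_star G x mu xi) + mu (bracket G xi x)).
rewrite -[RHS]/(nu x - Wmu xi) ad_starE.
have -> : bracket G x xi = - bracket G xi x by rewrite /bracket /jacobi_lie opprB.
by rewrite linearN opprB addrA addrAC subrK.
Qed.

Lemma lie_mul_smooth_at E' (M : manifold E') (a b : M -> G) (p : M) :
  smooth_at a p -> smooth_at b p -> smooth_at (fun q => right_mul (b q) (a q)) p.
Proof.
move=> sa sb.
exact: (smooth_at_comp (smooth_at_pair sa sb) (@lie_mul_smooth _ E G (a p, b p))).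
Qed.

Section Hamiltonian.
Context (H : TstarG G -> R).
Context (sH : smooth_map (M := TstarG G) (N := vec_mfd R) H).

(** [TstarG G] acts on itself by right multiplication and addition. Differentiating
    the translates of [H] at one fixed point expresses all the covectors [dH] in one
    chart, which makes their smooth dependence on the point visible. *)
Definition translated (r : prod_mfd (TstarG G) (TstarG G)) : vec_mfd R :=
  H (right_mul r.2.1 r.1.1, r.1.2 + r.2.2).

Definition unit_point : TstarG G := (lie_one G, 0).

Definition trivialized_diff (q : TstarG G) : dual_space (E * dual_space E)%type :=
  to_dual (differential (M := TstarG G) (fun r => translated (r, q)) unit_point).

Lemma translated_smooth :
  smooth_map (M := prod_mfd (TstarG G) (TstarG G)) (N := vec_mfd R) translated.
Proof.
move=> r.
have f := @smooth_at_fst R _ _ (TstarG G) (TstarG G) r.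
have s := @smooth_at_snd R _ _ (TstarG G) (TstarG G) r.
have f1 := smooth_at_comp f (@smooth_at_fst R _ _ G (vec_mfd (dual_space E)) r.1).
have f2 := smooth_at_comp f (@smooth_at_snd R _ _ G (vec_mfd (dual_space E)) r.1).
have s1 := smooth_at_comp s (@smooth_at_fst R _ _ G (vec_mfd (dual_space E)) r.2).
have s2 := smooth_at_comp s (@smooth_at_snd R _ _ G (vec_mfd (dual_space E)) r.2).
exact: (smooth_at_comp (smooth_at_pair (lie_mul_smooth_at f1 s1) (smooth_at_add f2 s2)) (sH _)).
Qed.

Lemma trivialized_diff_smooth :
  smooth_map (N := vec_mfd (dual_space (E * dual_space E)%type)) trivialized_diff.
Proof. exact: (smooth_partial_differential unit_point translated_smooth). Qed.

Lemma trivialized_diffE (q : TstarG G) (xi : E) (b : dual_space E) :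
  trivialized_diff q (xi, b) =
  differential (M := TstarG G) H q (right_field xi q.1, b).
Proof.
pose T (r : TstarG G) : TstarG G := (right_mul q.1 r.1, r.2 + q.2).
have T1 : T unit_point = q.
  by rewrite /T /unit_point /right_mul /lie_one /= mul1g add0r -surjective_pairing.
have f := @smooth_at_fst R _ _ G (vec_mfd (dual_space E)) unit_point.
have s := @smooth_at_snd R _ _ G (vec_mfd (dual_space E)) unit_point.
have m1 : smooth_at (M := TstarG G) (N := G) (fun r => right_mul q.1 r.1) unit_point.
  by apply: lie_mul_smooth_at f _; exact: smooth_at_cst.
have a1 : smooth_at (M := TstarG G) (N := vec_mfd (dual_space E))
    (fun r => r.2 + q.2) unit_point.
  by apply: smooth_at_add s _; exact: smooth_at_cst.
have sT : smooth_at (N := TstarG G) T unit_point := smooth_at_pair m1 a1.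
have sHT : smooth_at (M := TstarG G) (N := vec_mfd R) (H \o T) unit_point.
  exact: (smooth_at_comp sT (sH _)).
rewrite /trivialized_diff (to_dual_differential _ sHT).
have dT := smooth_differentiable_at sT.
have [_ TE] := tangent_map_comp dT (smooth_differentiable_at (sH (T unit_point))).
rewrite /differential.
rewrite -[LHS]/(tangent_map (M := TstarG G) (N := vec_mfd R) (H \o T) unit_point (xi, b)).
rewrite TE /= T1; congr (tangent_map _ _ _).
have [_ fE] := tangent_map_comp dT
  (smooth_differentiable_at (@smooth_at_fst R _ _ G (vec_mfd (dual_space E)) (T unit_point))).
have [_ sE] := tangent_map_comp dT
  (smooth_differentiable_at (@smooth_at_snd R _ _ G (vec_mfd (dual_space E)) (T unit_point))).
rewrite [LHS]surjective_pairing; congr pair.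
  have := congr1 (@^~ (xi, b)) fE; rewrite (tangent_map_fst (T unit_point)) /= => <-.
  have [_ E2] := tangent_map_comp (smooth_differentiable_at f)
    (right_mul_differentiable q.1 (unit_point.1)).
  by rewrite -[LHS]/(tangent_map (M := TstarG G) (right_mul q.1 \o fst) unit_point (xi, b))
    E2 (tangent_map_fst unit_point).
have := congr1 (@^~ (xi, b)) sE; rewrite (tangent_map_snd (T unit_point)) /= => <-.
have [d2 E2] := snd_diff (chart_at unit_point unit_point).
have E3 := congr1 (@^~ (xi, b)) (etrans (diff_add_cst q.2 d2) E2).
exact: E3.
Qed.

Lemma differential_split (q : TstarG G) (a : E) (b : dual_space E) :
  differential (M := TstarG G) H q (a, b) =
  differential (M := G) (fun g => H (g, q.2)) q.1 a +
  differential (M := vec_mfd (dual_space E)) (fun mu => H (q.1, mu)) q.2 b.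
Proof.
have [_ dH] := smooth_differentiable_at (sH q).
set Hc := local_rep _ _ in dH.
have dH' : differentiable Hc (chart_at q.1 q.1, q.2) by [].
have E1 : local_rep (M := vec_mfd (dual_space E)) (N := vec_mfd R)
    (fun mu => H (q.1, mu)) q.2 = (fun m => Hc (chart_at q.1 q.1, m)).
  apply/funext => x; rewrite -[RHS]/(H
    (chart_inv (chart_at q.1) (chart_at q.1 q.1), x)).
  by rewrite chart_atK//; exact: chart_at_dom.
rewrite /differential /tangent_map E1 -/Hc.
rewrite -[X in _ = X + _]/('d (fun x => Hc (x, q.2)) (chart_at q.1 q.1) a).
rewrite (diff_slice1 dH').2 (diff_slice2 dH').2 -linearD; congr ('d _ _ _).
by congr pair; rewrite /= ?addr0 ?add0r.
Qed.

(** Over each [q], the unique solution of the equation [- tau^* dH = theta1], see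
    [theta1_graphE]. *)
Definition ham_section (q : TstarG G) : vec_mfd (E * dual_space E)%type :=
  (delta_mu H q, - right_cotriv q.1 (delta_g H q)).

Context (reflE : reflexive_space E).

Lemma pairing_ham_section (q : TstarG G) (xi : E) (b : dual_space E) :
  pairing (ham_section q) (xi, b) =
  - differential (M := TstarG G) H q (right_field xi q.1, b).
Proof.
rewrite /pairing /ham_section /= differential_split opprD.
rewrite (delta_muE sH)//; congr (_ - _).
rewrite -[LHS]/(- right_cotriv q.1 (delta_g H q) xi).
by rewrite right_cotrivE delta_gE.
Qed.

(** The section is the image of [- trivialized_diff] under the inverse of the
    pairing, which is linear and continuous. *)
Lemma ham_section_smooth :
  smooth_map (N := vec_mfd (E * dual_space E)%type) ham_section.
Proof.
have [L [cL LE]] := pairing_inverse reflE.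
have -> : ham_section = (fun q => - L (trivialized_diff q)).
  apply/funext => q; apply: pairing_inj => -[xi b].
  rewrite pairing_ham_section -[in RHS]linearN LE.
  by rewrite -[RHS]/(- trivialized_diff q (xi, b)) trivialized_diffE.
move=> q; apply: smooth_at_opp.
apply: (smooth_at_comp (trivialized_diff_smooth q)
  (g := (L : vec_mfd (dual_space (E * dual_space E)%type) ->
         vec_mfd (E * dual_space E)%type))).
exact: smooth_at_linear.
Qed.

(** In the right trivialization both sides are values of the pairing, at
    [ham_section H p.1] and at [p.2]. *)
Lemma theta1_graphE (p : TTstarG G) :
  (forall W, - pullback (tau (G := G)) (differential H) p W = theta1 p W) <->
  p.2 = ham_section p.1.
Proof.
have TW W : - pullback (tau (G := G)) (differential H) p W =
    pairing (ham_section p.1) (right_triv p.1.1 W.1.1, W.1.2).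
  rewrite pairing_ham_section right_trivK /pullback.
  rewrite -[tangent_map _ p]/(tangent_map (M := TTstarG G) (N := TstarG G) fst p).
  rewrite (@tangent_map_fst R _ _ (TstarG G) (vec_mfd (E * dual_space E)%type) p).
  by case: W => -[].
split=> [eqW|pE W]; last by rewrite TW theta1E pE.
apply: pairing_inj => -[xi b].
have := eqW ((right_field xi p.1.1, b), 0).
by rewrite TW theta1E /= right_fieldK => ->.
Qed.

End Hamiltonian.

End LieGraph.

(** * The one-form in charts *)

Section ProductForms.
Context {R : realType}.

Lemma tangent_map_chart_inv_vec (E : normedModType R) (w : vec_mfd E) (y v : E) :
  tangent_map (M := vec_mfd E) (N := vec_mfd E) (chart_inv (chart_at w)) y v = v.
Proof.
have H : 'd (@id E) y = id :> (E -> E) by exact: diff_val.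
exact: (congr1 (@^~ v) H).
Qed.

Lemma tangent_map_chart_inv_prod (E F : normedModType R) (M : manifold E)
    (N : manifold F) (p : prod_mfd M N) (y v : E * F) : chart_cod (chart_at p) y ->
  tangent_map (M := vec_mfd (E * F)%type) (chart_inv (chart_at p)) y v =
  (tangent_map (M := vec_mfd E) (chart_inv (chart_at p.1)) y.1 v.1,
   tangent_map (M := vec_mfd F) (chart_inv (chart_at p.2)) y.2 v.2).
Proof.
move=> cy; have dc := smooth_differentiable_at (smooth_at_chart_inv cy).
have [cy1 cy2] : chart_cod (chart_at p.1) y.1 /\ chart_cod (chart_at p.2) y.2.
  by move: cy; rewrite prod_chart_cod => -[].
have d1 := smooth_differentiable_at (smooth_at_chart_inv cy1).
have d2 := smooth_differentiable_at (smooth_at_chart_inv cy2).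
set q := chart_inv (chart_at p) y.
have [_ E1] := tangent_map_comp dc (smooth_differentiable_at (@smooth_at_fst _ _ _ M N q)).
have [_ E2] := tangent_map_comp dc (smooth_differentiable_at (@smooth_at_snd _ _ _ M N q)).
have [df fE] := fst_diff y; have [ds sE] := snd_diff y.
have df' : differentiable_at (M := vec_mfd (E * F)%type) (N := vec_mfd E) fst y.
  by split=> //; exact: cvg_fst.
have ds' : differentiable_at (M := vec_mfd (E * F)%type) (N := vec_mfd F) snd y.
  by split=> //; exact: cvg_snd.
have [_ E1'] := tangent_map_comp df' d1.
have [_ E2'] := tangent_map_comp ds' d2.
rewrite (tangent_map_fst q) in E1; rewrite (tangent_map_snd q) in E2.
have T1 : tangent_map (M := vec_mfd (E * F)%type) (N := vec_mfd E) fst y = fst := fE.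
have T2 : tangent_map (M := vec_mfd (E * F)%type) (N := vec_mfd F) snd y = snd := sE.
rewrite [LHS]surjective_pairing; congr pair.
  apply: etrans (esym (congr1 (@^~ v) E1)) _.
  apply: etrans (congr1 (@^~ v) E1') _.
  by rewrite /= T1.
apply: etrans (esym (congr1 (@^~ v) E2)) _.
apply: etrans (congr1 (@^~ v) E2') _.
by rewrite /= T2.
Qed.

End ProductForms.

Section ThetaForm.
Context {R : realType} {E : completeNormedModType R} (G : lieGroup E).

Definition right_triv_rep (p : G) (x a : E) : E :=
  right_triv (chart_inv (chart_at p) x)
    (tangent_map (M := vec_mfd E) (chart_inv (chart_at p)) x a).

(** This is the partial derivative at [y = x] of the smooth map
    [(y, x) |-> h y * (h x)^-1], where [h] is the inverse of the chart. *)
Lemma right_triv_rep_smooth (p : G) (a : E) :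
  smooth_near (fun x => right_triv_rep p x a) (chart_at p p).
Proof.
pose h : vec_mfd E -> G := chart_inv (chart_at p).
pose Q (r : prod_mfd (vec_mfd E) (vec_mfd E)) : G :=
  right_mul (lie_inv (h r.2)) (h r.1).
have Q1 x : Q (x, x) = lie_one G by rewrite /Q /right_mul /lie_inv /lie_one mulgV.
pose Qc (r : E * E) : E := chart_at (lie_one G) (Q r).
have sQ x : chart_cod (chart_at p) x -> smooth_near Qc (x, x).
  move=> cx; have sh := smooth_at_chart_inv cx.
  have s1 := smooth_at_comp (@smooth_at_fst R _ _ (vec_mfd E) (vec_mfd E) (x, x)) sh.
  have s2 := smooth_at_comp (@smooth_at_snd R _ _ (vec_mfd E) (vec_mfd E) (x, x)) sh.
  have s3 := smooth_at_comp s2 (@lie_inv_smooth _ E G (h x)).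
  have [_] : smooth_at (M := prod_mfd (vec_mfd E) (vec_mfd E)) Q (x, x).
    exact: lie_mul_smooth_at s1 s3.
  by rewrite /local_rep Q1.
have cod0 := @near_chart_cod _ E G p.
apply: (@smooth_near_eq _ _ _ (fun x => 'd Qc (x, x) (a, 0))).
  apply: filterS cod0 => x cx; set g := h x.
  have [_ TE] := tangent_map_comp (smooth_differentiable_at (smooth_at_chart_inv cx))
    (right_mul_differentiable (lie_inv g) g).
  rewrite -(diff_slice1 (smooth_near_differentiable (sQ x cx))).2.
  apply: etrans _ (congr1 (@^~ a) TE).
  rewrite /tangent_map /local_rep.
  have -> : ((right_mul (lie_inv g) \o chart_inv (chart_at p)) x) = lie_one G.
    by rewrite -(Q1 x).
  by [].
have sd : smooth_near (fun x : E => ((x, x), (a, 0 : E))) (chart_at p p).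
  have si : smooth_near (idfun : {linear E -> E}) (chart_at p p).
    by apply: smooth_near_linear => x; exact: cvg_id.
  by do 2!apply: smooth_near_pair => //; exact: smooth_near_cst.
apply: (smooth_near_comp sd (g := fun r : (E * E) * (E * E) => 'd Qc (r.1) r.2)).
by apply: smooth_near_tangent; apply: sQ; exact: chart_cod_at.
Qed.

Lemma form_rep_theta1 (p : TTstarG G) y v : chart_cod (chart_at p) y ->
  form_rep (theta1 (G := G)) p y v =
  pairing y.2 (right_triv_rep p.1.1 y.1.1 v.1.1, v.1.2).
Proof.
move=> cy; have cy1 : chart_cod (chart_at p.1) y.1.
  by move: cy; rewrite prod_chart_cod => -[].
rewrite /form_rep theta1E.
rewrite (tangent_map_chart_inv_prod (M := TstarG G)
  (N := vec_mfd (E * dual_space E)%type) v cy) /=.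
by rewrite (tangent_map_chart_inv_prod (M := G)
  (N := vec_mfd (dual_space E)) v.1 cy1) /= (tangent_map_chart_inv_vec p.1.2).
Qed.

Lemma pairing_rep_differentiable (p : TTstarG G) (v : (E * dual_space E) * (E * dual_space E)) :
  differentiable (fun y : (E * dual_space E) * (E * dual_space E) =>
    pairing y.2 (right_triv_rep p.1.1 y.1.1 v.1.1, v.1.2)) (chart_at p p).
Proof.
set y0 := chart_at p p.
have [d1 _] := fst_diff y0; have [d2 _] := snd_diff y0.
have [d11 _] := fst_diff y0.1.
have [d21 _] := fst_diff y0.2; have [d22 _] := snd_diff y0.2.
have dA := smooth_near_differentiable (right_triv_rep_smooth p.1.1 v.1.1).
have da : differentiable ((fun x => right_triv_rep p.1.1 x v.1.1) \o (fst \o fst)) y0.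
  by apply: differentiable_comp; [exact: differentiable_comp d1 d11|exact: dA].
have dn : differentiable (snd \o snd) y0 := differentiable_comp d2 d22.
have dx : differentiable (fst \o snd) y0 := differentiable_comp d2 d21.
have db : differentiable (v.1.2 : E -> R) (y0.2.1).
  by have [_ cb] := dualP v.1.2; exact: linear_differentiable.
apply: (@differentiableB _ _ _ (fun y : (E * dual_space E) * (E * dual_space E) =>
  y.2.2 (right_triv_rep p.1.1 y.1.1 v.1.1)) (v.1.2 \o (fst \o snd))).
  exact: (differentiable_comp (differentiable_pair dn da)
    (evaluation_differentiable _ _)).
exact: (differentiable_comp dx db).
Qed.

Lemma theta1_differentiable (p : TTstarG G) v :
  differentiable (fun y => form_rep (theta1 (G := G)) p y v) (chart_at p p) /\
  'd (fun y => form_rep (theta1 (G := G)) p y v) (chart_at p p) =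
  'd (fun y : (E * dual_space E) * (E * dual_space E) =>
    pairing y.2 (right_triv_rep p.1.1 y.1.1 v.1.1, v.1.2)) (chart_at p p)
  :> ((E * dual_space E) * (E * dual_space E) -> R).
Proof.
apply: near_eq_diff (pairing_rep_differentiable p v).
by apply: filterS (@near_chart_cod _ _ (TTstarG G) p) => y cy; rewrite form_rep_theta1.
Qed.

(** In a chart [theta1] is linear in the fibre coordinates [(xi, nu)]. *)
Lemma theta1_vertical (p : TTstarG G) w v :
  'd (fun y => form_rep (theta1 (G := G)) p y v) (chart_at p p) (0, w) =
  pairing w (right_triv p.1.1 v.1.1, v.1.2).
Proof.
rewrite (theta1_differentiable p v).2.
have dF : differentiable (fun y : (E * dual_space E) * (E * dual_space E) =>
    pairing y.2 (right_triv_rep p.1.1 y.1.1 v.1.1, v.1.2)) (chart_at p.1 p.1, p.2).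
  exact: pairing_rep_differentiable.
rewrite -[chart_at p p]/(chart_at p.1 p.1, p.2) -(diff_slice2 dF).2 /=.
have -> : right_triv_rep p.1.1 (chart_at p.1.1 p.1.1) v.1.1 = right_triv p.1.1 v.1.1.
  by rewrite /right_triv_rep tangent_map_chart_inv chart_atK//; exact: chart_at_dom.
pose z := (right_triv p.1.1 v.1.1, v.1.2).
pose m := GRing.isLinear.Build _ _ _ _ _ (pairing_linearl z).
pose L : {linear (E * dual_space E)%type -> R} := HB.pack (pairing^~ z) m.
have cL : continuous L by exact: pairing_continuousl.
have LE : 'd L (p.2 : E * dual_space E) = L :> (E * dual_space E -> R).
  exact: diff_lin.
exact: (congr1 (fun f => f w) LE).
Qed.

End ThetaForm.

(** * Hamilton's equations *)

Section HamiltonianLagrangian.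
Context {R : realType} {E : completeNormedModType R} (G : lieGroup E).
Context (reflE : reflexive_space E) (H : TstarG G -> R).
Context (sH : smooth_map (M := TstarG G) (N := vec_mfd R) H).

Lemma hamiltonian_lagrangian :
  lagrangian_submanifold (M := TTstarG G) (Omega (G := G))
    [set p | p.2 = ham_section H p.1].
Proof.
pose B (p : TTstarG G) (w z : E * dual_space E) : R :=
  pairing w (right_triv p.1.1 z.1, z.2).
apply: (@graph_lagrangian R _ _ (TstarG G) (ham_section H) H
  (ham_section_smooth sH reflE) sH (theta1 (G := G)) B).
- by move=> q Sq w; rewrite -((theta1_graphE sH reflE q).2 Sq w).
- by move=> p _ v; exact: (theta1_differentiable p v).1.
- by move=> p _ w v; exact: theta1_vertical.
- move=> p _ w wB; apply: pairing_inj => -[xi b].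
  have := wB (right_field xi p.1.1, b); rewrite /B /= right_fieldK => ->.
  by rewrite /pairing /= linear0 subr0.
Qed.

Lemma trivialized_hamilton_equations (q : TstarG G) (Vg : E) (Vmu : dual_space E) :
  (trivialize q (Vg, Vmu)).2 = ham_section H q <->
  Vg = right_field (delta_mu H q) q.1 /\
  Vmu = ad_star G (delta_mu H q) q.2 - right_cotriv q.1 (delta_g H q).
Proof.
rewrite /trivialize /ham_section /=; split=> [eqp|[-> ->]].
  have /= xiE := congr1 fst eqp; have /= nuE := congr1 snd eqp.
  by rewrite -xiE right_trivK -nuE addrC subrK.
by rewrite right_fieldK addrAC subrr add0r.
Qed.

End HamiltonianLagrangian.

Theorem mainTheorem4 (R : realType) (E : completeNormedModType R)
    (G : lieGroup E) (reflE : reflexive_space E) (H : TstarG G -> R)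
    (smoothH : smooth_map (M := TstarG G) (N := vec_mfd R) H) :
  let S' : set (TTstarG G) :=
    [set p | forall W, - pullback (tau (G := G)) (differential H) p W =
                       theta1 p W] in
  lagrangian_submanifold (M := TTstarG G) (Omega (G := G)) S' /\
  forall (I : set R) (g : R -> G) (mu : R -> vec_mfd (dual_space E)),
    open I -> is_interval I ->
    (forall t, I t -> curve_differentiable g t /\ curve_differentiable mu t) ->
    ((forall t, I t ->
        S' (trivialize (g t, mu t) (velocity g t, velocity mu t))) <->
     (forall t, I t ->
        velocity g t = right_field (delta_mu H (g t, mu t)) (g t) /\
        velocity mu t = ad_star G (delta_mu H (g t, mu t)) (mu t) -
                        right_cotriv (g t) (delta_g H (g t, mu t)))).
Proof.
move=> S'.
have S'E : S' = [set p | p.2 = ham_section H p.1].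
  by apply/seteqP; split=> p /(theta1_graphE smoothH reflE p).
split; first by rewrite S'E; exact: hamiltonian_lagrangian.
move=> I g mu _ _ _.
have pointwise t : S' (trivialize (g t, mu t) (velocity g t, velocity mu t)) <->
    velocity g t = right_field (delta_mu H (g t, mu t)) (g t) /\
    velocity mu t = ad_star G (delta_mu H (g t, mu t)) (mu t) -
                    right_cotriv (g t) (delta_g H (g t, mu t)).
  by rewrite S'E; exact: trivialized_hamilton_equations.
by split=> S t It; apply/pointwise; exact: S.
Qed.
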